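(* Let $k,l\ge 0$ be integers and $n=k+l+1$. Let $A^k$ and $B^l$ be a $k$-sphere and an $l$-sphere which are embedded in $\mathbf{S}^n$ such that they are linked. Then $$\operatorname{d}(A,B)\le \pi/2,$$ and equality holds if and only if $A$ and $B$ are dual great sub-spheres in $\mathbf{S}^n$, i.e. $\mathbf{S}^n=A*B$, where $*$ denotes the spherical join (equivalently, there is a $(k+1)$-dimensional linear subspace $P\subset\mathbb{R}^{n+1}$ with $A=\mathbf{S}^n\cap P$ and $B=\mathbf{S}^n\cap P^{\perp}$).
   Context: $\mathbf{S}^n\subset\mathbb{R}^{n+1}$ is the unit sphere with its round metric of constant curvature $1$, and $\operatorname{d}(A,B)=\inf\{\operatorname{d}(a,b): a\in A,\ b\in B\}$, where $\operatorname{d}(a,b)$ is the geodesic (angular) distance. Linked: submanifolds $A,B\subset\mathbf{S}^n$ are called unlinked if there exists an embedded $(n-1)$-sphere $S$ in $\mathbf{S}^n$ such that $A$ and $B$ lie in complementary ''hemispheres'' determined by $S$, i.e. in the two different connected components of $\mathbf{S}^n\setminus S$; otherwise $A$ and $B$ are called linked. *)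

(* Defs.v *)
From HB Require Import structures.
From mathcomp Require Import all_boot all_order all_algebra.
From mathcomp Require Import all_classical all_reals all_analysis.
Import Order.TTheory GRing.Theory Num.Theory.
Import numFieldNormedType.Exports.

Set Implicit Arguments.
Unset Strict Implicit.
Unset Printing Implicit Defensive.

Local Open Scope classical_set_scope.
Local Open Scope ring_scope.

Section Spheres.
Variable R : realType.

(* The library norm on row vectors is the sup norm, hence an explicit
   Euclidean product; both norms induce the same topology. *)
Definition dot (m : nat) (x y : 'rV[R]_m) : R := \sum_i x 0 i * y 0 i.

Definition sphere (n : nat) : set 'rV[R]_n.+1 := [set x | dot x x = 1].

(* On the unit sphere of curvature 1, geodesic distance is the angle. *)
Definition geod_dist (m : nat) (a b : 'rV[R]_m) : R := acos (dot a b).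

Definition set_dist (m : nat) (A B : set 'rV[R]_m) : R :=
  inf [set geod_dist a b | a in A & b in B].

(* Class C^r on an open set U, by iterated directional derivatives. *)
Fixpoint class_C (r p q : nat) (U : set 'rV[R]_p.+1)
    (f : 'rV[R]_p.+1 -> 'rV[R]_q.+1) : Prop :=
  (forall x, U x -> {for x, continuous f}) /\
  match r with
  | 0%N => True
  | r'.+1 => forall v : 'rV[R]_p.+1,
      (forall x, U x -> derivable f x v) /\ class_C r' U (fun x => 'D_v f x)
  end.

(* A smooth embedding of S^k into R^(n+1). A smooth map on the compact
   submanifold S^k is the restriction of a smooth map on an open neighbourhood;
   by compactness an injective immersion of S^k is an embedding. The tangent
   space of S^k at x is the orthogonal complement of x. *)
Definition smooth_embedding (k n : nat)
    (f : 'rV[R]_k.+1 -> 'rV[R]_n.+1) : Prop :=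
  [/\ exists U : set 'rV[R]_k.+1,
        [/\ open U, sphere (n := k) `<=` U & forall r, class_C r U f],
      forall x y, sphere x -> sphere y -> f x = f y -> x = y
    & forall x v, sphere x -> dot x v = 0 -> v != 0 -> 'D_v f x != 0].

Definition embedded_sphere (k n : nat) (A : set 'rV[R]_n.+1) : Prop :=
  A `<=` sphere (n := n) /\
  exists f : 'rV[R]_k.+1 -> 'rV[R]_n.+1,
    smooth_embedding f /\ A = f @` sphere (n := k).

Definition is_component (T : topologicalType) (X C : set T) : Prop :=
  exists2 x, X x & C = connected_component X x.

(* Used for n >= 1 only, where n.-1 is the genuine n - 1. *)
Definition unlinked (n : nat) (A B : set 'rV[R]_n.+1) : Prop :=
  exists S C D : set 'rV[R]_n.+1,
    [/\ embedded_sphere n.-1 S,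
        is_component (sphere (n := n) `\` S) C,
        is_component (sphere (n := n) `\` S) D,
        C <> D
      & A `<=` C /\ B `<=` D].

Definition linked (n : nat) (A B : set 'rV[R]_n.+1) : Prop := ~ unlinked A B.

(* S^n = A * B: any a in A and b in B are at distance pi/2, as in the join
   metric, and the minimal geodesics t |-> cos t a + sin t b joining them
   fill S^n. *)
Definition sphere_is_join (n : nat) (A B : set 'rV[R]_n.+1) : Prop :=
  (forall a b, A a -> B b -> geod_dist a b = pi / 2) /\
  sphere (n := n) = [set x | exists a b t,
    [/\ A a, B b, 0 <= t <= pi / 2 & x = cos t *: a + sin t *: b]].

Definition orthogonal_complement (m : nat) (P : {vspace 'rV[R]_m}) :
    set 'rV[R]_m :=
  [set x | forall y, y \in P -> dot x y = 0].

Definition dual_great_spheres (k n : nat) (A B : set 'rV[R]_n.+1) : Prop :=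
  exists P : {vspace 'rV[R]_n.+1},
    [/\ \dim P = k.+1,
        A = sphere (n := n) `&` [set x | x \in P]
      & B = sphere (n := n) `&` orthogonal_complement P].

End Spheres.

(* Main.v *)
Require Import Defs.
From HB Require Import structures.
From mathcomp Require Import all_boot all_order all_algebra.
From mathcomp Require Import all_classical all_reals all_analysis.
From mathcomp Require Import zify ring lra.
Import Order.TTheory GRing.Theory Num.Theory.
Import numFieldNormedType.Exports.
Local Open Scope classical_set_scope.
Local Open Scope ring_scope.

Set Implicit Arguments.
Unset Strict Implicit.
Unset Printing Implicit Defensive.

(** The proof has two halves. The first shows that linked spheres whose
distance is at least pi/2 are orthogonal, that is, [dot a b = 0] for all a in A
and b in B; the second that orthogonality forces A and B to be dual great
spheres.

Suppose [dot a b <= 0] throughout. Let K be the dual cone of A, which contains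
-B, let p be a sum of points of A that span the linear hull of A, and let d be
the point of K nearest to p, so that [dot (p - d) x <= 0] on K. If d = 0, this
says [dot p x <= 0] for x in K; being a sum of nonnegative terms, [dot p x]
vanishes, so every such x, in particular every -b, is orthogonal to A. If d is
nonzero, the hyperplane orthogonal to d separates A and B weakly, and the
inequality at x = -b gives [dot d b <= dot p b <= 0]: B touches the hyperplane
only in points orthogonal to A. The great sphere in this hyperplane can
therefore be bent. Put c = d/|d|, let y be the component of x orthogonal to c,
and let Q be a quadratic form that vanishes on A and c and is positive on the
nonzero vectors orthogonal to A. For small del > 0 the function
[dot x c + (del |y|^2 - Q y) / |y|] is positive on A, where Q vanishes, and
negative on B, by compactness of B. Its zero set is a graph over the great
sphere orthogonal to c, hence a smoothly embedded sphere, and the regions where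
it is positive or negative are star-shaped about c and -c. So A and B are
unlinked ([separating_hypersurface], [linked_orthogonal]).

Now suppose A and B orthogonal, with linear hulls P and Q. At a point x of the
parameter sphere, f(x) and the image of the tangent space span a subspace of P
of dimension k + 1, so dim P >= k + 1; likewise dim Q >= l + 1. As P and Q are
orthogonal in dimension k + l + 2, both are equalities. Then A fills the unit
sphere of P: given a unit vector y in P, let x maximise [dot y (f x)]. The
derivative vanishes, so y is orthogonal to the tangent image, which has
codimension one in P, and y = f(x) or y = -f(x). In the second case the maximum
would be -1, the least possible value, and f would be constant,
against injectivity ([embedded_sphere_span], [orthogonal_dual_great_spheres]). *)

(** * The Euclidean product *)

Section Dot.
Variables (R : realType) (m : nat).
Implicit Types x y z : 'rV[R]_m.

Lemma dotE x y : dot x y = (x *m y^T) 0 0.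
Proof. by rewrite mxE; apply: eq_bigr => i _; rewrite mxE. Qed.

Lemma dotC x y : dot x y = dot y x.
Proof. by apply: eq_bigr => i _; rewrite mulrC. Qed.

Lemma dotDl x y z : dot (x + y) z = dot x z + dot y z.
Proof. by rewrite !dotE mulmxDl mxE. Qed.

Lemma dotZl a x y : dot (a *: x) y = a * dot x y.
Proof. by rewrite !dotE -scalemxAl mxE. Qed.

Lemma dotNl x y : dot (- x) y = - dot x y.
Proof. by rewrite -scaleN1r dotZl mulN1r. Qed.

Lemma dotBl x y z : dot (x - y) z = dot x z - dot y z.
Proof. by rewrite dotDl dotNl. Qed.

Lemma dotDr x y z : dot x (y + z) = dot x y + dot x z.
Proof. by rewrite dotC dotDl !(dotC x). Qed.

Lemma dotZr a x y : dot x (a *: y) = a * dot x y.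
Proof. by rewrite dotC dotZl dotC. Qed.

Lemma dotNr x y : dot x (- y) = - dot x y.
Proof. by rewrite dotC dotNl dotC. Qed.

Lemma dotBr x y z : dot x (y - z) = dot x y - dot x z.
Proof. by rewrite dotDr dotNr. Qed.

Lemma dot0l y : dot 0 y = 0.
Proof. by rewrite dotE mul0mx mxE. Qed.

Lemma dot0r y : dot y 0 = 0.
Proof. by rewrite dotC dot0l. Qed.

Definition dotD := (dotDl, dotDr, dotZl, dotZr, dotNl, dotNr, dot0l, dot0r).

Lemma dot_suml (I : Type) (r : seq I) (F : I -> 'rV[R]_m) y :
  dot (\sum_(i <- r) F i) y = \sum_(i <- r) dot (F i) y.
Proof.
by elim/big_rec2: _ => [|i u v _ <-]; rewrite ?dot0l // dotDl.
Qed.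

Lemma dot_ge0 x : 0 <= dot x x.
Proof. by apply: sumr_ge0 => i _; rewrite -expr2 sqr_ge0. Qed.

Lemma dot_eq0 x : (dot x x == 0) = (x == 0).
Proof.
apply/idP/eqP => [/eqP|->]; last by rewrite dot0l.
move/psumr_eq0P => h; apply/rowP => i; rewrite mxE.
have sq i0 : true -> 0 <= x 0 i0 * x 0 i0 by rewrite -expr2 sqr_ge0.
have /eqP := h sq i isT.
by rewrite mulf_eq0 orbb => /eqP.
Qed.

Lemma dot_gt0 x : (0 < dot x x) = (x != 0).
Proof. by rewrite lt_def dot_eq0 dot_ge0 andbT. Qed.

Lemma dot_CS x y : dot x y ^+ 2 <= dot x x * dot y y.
Proof.
have [->|y0] := eqVneq y 0; first by rewrite !dot0r mulr0 expr0n.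
have yy : 0 < dot y y by rewrite dot_gt0.
have := dot_ge0 (dot y y *: x - dot x y *: y).
rewrite dotBl !dotBr !dotD (dotC y x).
set a := dot x x; set b := dot x y; set e := dot y y in yy *.
have -> : e * (e * a) - e * (b * b) - (b * (e * b) - b * (b * e)) =
  e * (a * e - b ^+ 2) by ring.
by rewrite pmulr_rge0 // subr_ge0.
Qed.

Lemma dot_unit_itv x y : dot x x = 1 -> dot y y = 1 -> -1 <= dot x y <= 1.
Proof.
by move=> xx yy; have := dot_CS x y; rewrite xx yy mulr1 => h; nra.
Qed.

Lemma coord_sqr_le_dot x i : x 0 i ^+ 2 <= dot x x.
Proof.
rewrite /dot (bigD1 i) //= -expr2 lerDl.
by apply: sumr_ge0 => j _; rewrite -expr2 sqr_ge0.
Qed.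

End Dot.

Lemma dot_mulmx (R : realType) m p (x : 'rV[R]_m) (M : 'M[R]_(m, p)) y :
  dot (x *m M) y = dot x (y *m M^T).
Proof. by rewrite !dotE trmx_mul trmxK mulmxA. Qed.

Section DotTopology.
Variables (R : realType) (m : nat).
Implicit Types x y z : 'rV[R]_m.

Lemma continuous_dot (T : topologicalType) (f g : T -> 'rV[R]_m) (t : T) :
  {for t, continuous f} -> {for t, continuous g} ->
  {for t, continuous (fun s => dot (f s) (g s))}.
Proof.
move=> cf cg; apply: cvg_big => [|i _]; first exact: add_continuous.
have c (h : T -> 'rV[R]_m) : {for t, continuous h} ->
    h s 0 i @[s --> t] --> h t 0 i.
  move=> ch; apply: (@continuous_comp _ _ _ h (fun y : 'rV[R]_m => y 0 i)) => //.
  exact: coord_continuous.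
by apply: (@cvgM _ _ _ _ (fun s => f s 0 i) (fun s => g s 0 i)); exact: c.
Qed.

(** The topology of row vectors is that of the sup norm, so compactness has to
come from a cube: each coordinate satisfies x_i^2 <= r, hence |x_i| <= 1 + r. *)
Lemma compact_dot_le (r : R) (K : set 'rV[R]_m) :
  closed K -> (forall x, K x -> dot x x <= r) -> compact K.
Proof.
move=> cK Kr.
apply: (@subclosed_compact _ _ [set v : 'rV[R]_m |
    forall i, `[- (1 + r), 1 + r]%classic (v ord0 i)]) => //.
  by apply: (@rV_compact _ _ (fun=> `[- (1 + r), 1 + r]%classic)) => i;
    exact: segment_compact.
move=> x /Kr xr i /=; rewrite in_itv /=.
have := le_trans (coord_sqr_le_dot x i) xr.
by rewrite (_ : ord0 = 0) //; nra.
Qed.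

End DotTopology.

Section EuclideanNorm.
Variable R : realType.

Definition enorm n (y : 'rV[R]_n) : R := Num.sqrt (dot y y).

Lemma enorm_sqr n (y : 'rV[R]_n) : enorm y * enorm y = dot y y.
Proof. by rewrite -expr2 sqr_sqrtr // dot_ge0. Qed.

Lemma enormZ n (t : R) (y : 'rV[R]_n) : 0 <= t -> enorm (t *: y) = t * enorm y.
Proof.
move=> t0; rewrite /enorm dotZl dotZr mulrA -expr2 sqrtrM ?sqr_ge0 //.
by rewrite sqrtr_sqr ger0_norm.
Qed.

Lemma enorm_gt0 n (y : 'rV[R]_n) : (0 < enorm y) = (y != 0).
Proof. by rewrite sqrtr_gt0 dot_gt0. Qed.

Lemma enorm0 n : enorm (0 : 'rV[R]_n) = 0.
Proof. by rewrite /enorm dot0l sqrtr0. Qed.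

Lemma continuous_enorm n : continuous (@enorm n).
Proof.
move=> y; apply: (@continuous_comp _ _ _ (fun y => dot y y) (@Num.sqrt R)).
  by apply: continuous_dot.
exact: sqrt_continuous.
Qed.

End EuclideanNorm.

Lemma delta_sphere (R : realType) n : sphere (delta_mx 0 0 : 'rV[R]_n.+1).
Proof. by rewrite /sphere /= dotE trmx_delta mul_delta_mx mxE eqxx. Qed.

Lemma sphere_compact (R : realType) n : compact (sphere (R := R) (n := n)).
Proof.
apply: (@compact_dot_le _ _ 1) => [|x /= -> //].
rewrite (_ : @sphere R n = (fun x : 'rV[R]_n.+1 => dot x x) @^-1` [set 1]) //.
apply: closed_comp; last exact: closed_eq.
by move=> x _; apply: continuous_dot.
Qed.

(** * Orthogonality and linear subspaces *)

Section Orthogonal.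
Variables (R : realType) (m : nat).
Implicit Types (x y z : 'rV[R]_m) (P Q : {vspace 'rV[R]_m}).

(** If the rows of G form a basis of P, then G G^T is invertible, because
v G G^T = 0 makes |v G|^2 vanish; the projection of x to P is
x G^T (G G^T)^-1 G. *)
Lemma orthogonal_decomposition P x :
  exists p q, [/\ p \in P, orthogonal_complement P q & x = p + q].
Proof.
pose G := \matrix_(i < \dim P) (vbasis P)`_i.
have GE v : v *m G = \sum_i v 0 i *: (vbasis P)`_i.
  by rewrite mulmx_sum_row; apply: eq_bigr => i _; rewrite rowK.
have GP v : v *m G \in P.
  rewrite GE; apply: memv_suml => i _; apply: memvZ.
  by apply: vbasis_mem; apply: mem_nth; rewrite size_tuple.
have Gu : G *m G^T \in unitmx.
  rewrite -row_free_unit; apply: inj_row_free => v v0.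
  have : dot (v *m G) (v *m G) = 0.
    by rewrite dot_mulmx -mulmxA v0 dot0r.
  move/eqP; rewrite dot_eq0 GE => /eqP s0.
  have /freeP fr := basis_free (vbasisP P).
  by apply/rowP => i; rewrite mxE; apply: (fr (fun i => v 0 i)).
exists (x *m G^T *m invmx (G *m G^T) *m G).
exists (x - x *m G^T *m invmx (G *m G^T) *m G); split=> //; last first.
  by rewrite addrC subrK.
move=> y yP.
have -> : y = (\row_i coord (vbasis P) i y) *m G.
  rewrite GE {1}(coord_vbasis yP); apply: eq_bigr => i _.
  by rewrite mxE.
rewrite dotC dot_mulmx mulmxBl -!mulmxA mulVmx // mulmx1.
by rewrite subrr dot0r.
Qed.

Lemma mem_orthogonalP P z :
  (forall y, orthogonal_complement P y -> dot y z = 0) -> z \in P.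
Proof.
move=> h; have [p [q [pP qP zE]]] := orthogonal_decomposition P z.
have /eqP : dot q q = 0.
  by have := h q qP; rewrite zE dotDr (qP p pP) add0r.
by rewrite dot_eq0 zE => /eqP ->; rewrite addr0.
Qed.

Lemma orthogonal_span (s : seq 'rV[R]_m) y :
  (forall x, x \in s -> dot y x = 0) -> orthogonal_complement (span s) y.
Proof.
move=> h x xs; rewrite (coord_span (X := in_tuple s) xs).
rewrite dotC dot_suml big1 // => i _.
by rewrite dotZl dotC h ?mulr0 // mem_nth.
Qed.

(** Vectors of A outside the span are added one at a time; each raises the
dimension, which is bounded. *)
Lemma spanning_subset (A : set 'rV[R]_m) : exists s : seq 'rV[R]_m,
  (forall a, a \in s -> A a) /\ (forall a, A a -> a \in span s).
Proof.
pose Good (s : seq 'rV[R]_m) := forall a : 'rV[R]_m, a \in s -> A a.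
have step j : (exists s, Good s /\ (j <= \dim (span s))%N) \/
    exists s, Good s /\ (forall a, A a -> a \in span s).
  elim: j => [|j [[s [gs js]]|]]; last by right.
    by left; exists [::].
  case: (pselect (forall a, A a -> a \in span s)) => [h|].
    by right; exists s.
  move/existsNP => [a /not_implyP[Aa /negP an]]; left; exists (a :: s); split.
    by move=> b; rewrite inE => /orP[/eqP ->|/gs].
  apply: leq_ltn_trans js _; rewrite span_cons.
  rewrite ltn_neqAle dimvS ?addvSr // andbT.
  apply: contra an => /eqP e.
  have /eqP -> : (span s == <[a]> + span s)%VS by rewrite eqEdim addvSr e leqnn.
  by rewrite memvE addvSl.
case: (step m.+1) => // -[s [_ h]]; exfalso.
have := leq_trans h (dimvS (subvf _)).
by rewrite dimvf /dim /= mul1n ltnn.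
Qed.

Lemma dim_orthogonal P Q :
  (forall p q, p \in P -> q \in Q -> dot p q = 0) ->
  (\dim P + \dim Q <= m)%N.
Proof.
move=> h; rewrite -dimv_disjoint_sum; last first.
  apply/eqP; rewrite -subv0; apply/subvP => x; rewrite memv_cap => /andP[xP xQ].
  by rewrite memv0 -dot_eq0 h.
by apply: leq_trans (dimvS (subvf _)) _; rewrite dimvf /dim /= mul1n.
Qed.

Lemma orthogonal_complement_eq P Q :
  (forall p q, p \in P -> q \in Q -> dot p q = 0) -> (\dim P + \dim Q)%N = m ->
  [set x | x \in Q] = orthogonal_complement P.
Proof.
move=> h d; apply/seteqP; split=> x /=.
  by move=> xQ y yP; rewrite dotC h.
move=> xP.
have /eqP PQ : (P + Q == fullv)%VS.
  rewrite eqEdim subvf dimv_disjoint_sum ?d ?dimvf /dim /= ?mul1n //.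
  apply/eqP; rewrite -subv0; apply/subvP => y; rewrite memv_cap => /andP[yP yQ].
  by rewrite memv0 -dot_eq0 h.
have /memv_addP[p pP [q qQ xE]] : x \in (P + Q)%VS by rewrite PQ memvf.
suff p0 : p = 0 by rewrite xE p0 add0r.
apply/eqP; rewrite -dot_eq0.
by have := xP p pP; rewrite xE dotDl (dotC q) (h p q) // addr0 => ->.
Qed.

End Orthogonal.

(** * Derivatives along paths *)

Section PathDerivative.
Variables (R : realType) (V : normedModType R).
Implicit Types (g : V -> R) (x z v w : V).

Lemma is_derive_line (W : normedModType R) (g : V -> W) z v (s : R) :
  derivable g (z + s *: v) v ->
  is_derive s (1 : R) (fun s => g (z + s *: v)) ('D_v g (z + s *: v)).
Proof.
have E : (fun h : R => h^-1 *: (((fun s => g (z + s *: v)) \o shift s) (h *: (1 : R))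
     - g (z + s *: v))) =
   (fun h => h^-1 *: ((g \o shift (z + s *: v)) (h *: v) - g (z + s *: v))).
  apply/funext => h /=; congr (_ *: (g _ - _)).
  by rewrite [_%:A]mulr1 scalerDl addrCA.
by move=> gd; split; rewrite /derivable /derive E.
Qed.

(** The absolute values serve both signs of r at once. *)
Lemma mean_value_line g z v (r : R) :
  (forall s, `|s| <= `|r| -> derivable g (z + s *: v) v) ->
  exists2 s, `|s| <= `|r| & g (z + r *: v) - g z = r * 'D_v g (z + s *: v).
Proof.
move=> dg.
have dh s : `|s| <= `|r| -> is_derive s (1 : R) (fun s => g (z + s *: v))
    ('D_v g (z + s *: v)) by move=> /dg; exact: is_derive_line.
have ch (a b : R) : (forall s, s \in `[a, b] -> `|s| <= `|r|) ->
    {within `[a, b], continuous (fun s => g (z + s *: v))}.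
  move=> ab; apply: derivable_within_continuous => s /ab /dh.
  by move=> [].
have [r0|r0] := leP 0 r.
  have ab s : s \in `[0, r] -> `|s| <= `|r|.
    by rewrite in_itv /= => /andP[s0 sr]; rewrite !ger0_norm.
  have [s s0r E] := MVT_segment r0 (fun s h => dh s (ab s (subset_itv_oo_cc h)))
    (ch _ _ ab).
  exists s; first exact: ab.
  by move: E; rewrite scale0r addr0 subr0 mulrC.
have ab s : s \in `[r, 0] -> `|s| <= `|r|.
  by rewrite in_itv /= => /andP[s0 sr]; rewrite !ler0_norm ?lerN2 // ltW.
have [s s0r E] := MVT_segment (ltW r0)
  (fun s h => dh s (ab s (subset_itv_oo_cc h))) (ch _ _ ab).
exists s; first exact: ab.
move: E; rewrite scale0r addr0 sub0r => E.
by rewrite -opprB E; ring.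
Qed.

(** Difference quotient in direction v, seen as a function of the base point and
of the step together; at step 0 it is the directional derivative. *)
Definition slope g v (p : V * R) : R :=
  if p.2 == 0 then 'D_v g p.1 else p.2^-1 * (g (p.1 + p.2 *: v) - g p.1).

Lemma slopeE g v z r : g (z + r *: v) = g z + r * slope g v (z, r).
Proof.
rewrite /slope /=; have [->|r0] := eqVneq r 0.
  by rewrite scale0r mul0r !addr0.
by rewrite mulVKf // addrCA subrr addr0.
Qed.

(** The mean value theorem turns a difference quotient into a directional
derivative at a nearby point, and these are continuous. Joint continuity is
what allows the base point to move while the step tends to 0. *)
Lemma continuous_slope g x v : (\forall z \near x, derivable g z v) ->
  {for x, continuous (fun z => 'D_v g z)} ->
  {for (x, 0), continuous (slope g v)}.
Proof.
move=> dg cg; apply/cvgrPdist_le => e e0.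
move/cvgrPdist_le : (cg) => /(_ e e0) => ce.
have [d /= d0 bd] : nbhs_ball x ([set z | derivable g z v] `&`
    [set z | `|'D_v g x - 'D_v g z| <= e]).
  by apply/nbhs_ballP; exact: filterI.
have v1 : 0 < `|v| + 1 by rewrite ltr_wpDl.
have near1 : \forall p \near ((x, 0) : V * R), `|x - p.1| < d / 2.
  have : p.1 @[p --> ((x, 0) : V * R)] --> x by exact: cvg_fst.
  by move/cvgrPdist_lt => /(_ (d / 2) (divr_gt0 d0 (ltr0Sn _ _))).
have near2 : \forall p \near ((x, 0) : V * R), `|0 - p.2| < d / 2 / (`|v| + 1).
  have : p.2 @[p --> ((x, 0) : V * R)] --> (0 : R) by exact: cvg_snd.
  move/cvgrPdist_lt => /(_ (d / 2 / (`|v| + 1))); apply.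
  by rewrite divr_gt0 // divr_gt0.
near=> p.
have p1 : `|x - p.1| < d / 2 by near: p.
have p2 : `|p.2| * (`|v| + 1) < d / 2.
  have : `|0 - p.2| < d / 2 / (`|v| + 1) by near: p.
  by rewrite sub0r normrN ltr_pdivlMr.
have good s : `|s| <= `|p.2| -> ball x d (p.1 + s *: v).
  move=> sp; rewrite -ball_normE /= opprD addrA.
  apply: (le_lt_trans (ler_normB _ _)).
  rewrite (splitr d) ltrD // normrZ; apply: le_lt_trans p2.
  by rewrite ler_pM // lerDl.
rewrite {1}/slope /= eqxx /slope; case: eqP => [p20|/eqP p20].
  have g0 : `|0 : R| <= `|p.2| by rewrite normr0.
  by case: (bd _ (good 0 g0)); rewrite scale0r addr0.
have [s sp ->] := @mean_value_line g p.1 v p.2 (fun s h => (bd _ (good s h)).1).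
by rewrite mulKf //; case: (bd _ (good s sp)).
Unshelve. all: by end_near. Qed.

(** Going first along w and then along v, each increment is a step times a
slope, and both slopes converge by [continuous_slope]. This gives at once the
linearity of the derivative in its direction and the derivative along great
circles, which is all that the proof takes from the chain rule. *)
Lemma is_derive_path g x v w (al be : R -> R) (a b : R) :
  (\forall z \near x, derivable g z v) ->
  (\forall z \near x, derivable g z w) ->
  {for x, continuous (fun z => 'D_v g z)} ->
  {for x, continuous (fun z => 'D_w g z)} ->
  al 0 = 0 -> be 0 = 0 -> is_derive (0 : R) (1 : R) al a ->
  is_derive (0 : R) (1 : R) be b ->
  is_derive (0 : R) (1 : R) (fun t => g (x + al t *: v + be t *: w))
    (a * 'D_v g x + b * 'D_w g x).
Proof.
move=> dv dw cv cw al0 be0 dal dbe.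
have cal : {for (0 : R), continuous al}.
  by apply: differentiable_continuous; apply/derivable1_diffP; case: dal.
have cbe : {for (0 : R), continuous be}.
  by apply: differentiable_continuous; apply/derivable1_diffP; case: dbe.
have cal0 : al t @[t --> (0 : R)] --> (0 : R).
  by have := cal; rewrite /prop_for /continuous_at al0.
have cbe0 : be t @[t --> (0 : R)] --> (0 : R).
  by have := cbe; rewrite /prop_for /continuous_at be0.
pose F (t : R) := slope g v (x, al t).
pose G (t : R) := slope g w (x + al t *: v, be t).
have cF : F t @[t --> (0 : R)] --> 'D_v g x.
  have -> : 'D_v g x = slope g v (x, 0) by rewrite /slope /= eqxx.
  apply: (cvg_comp (fun t => (x, al t)) (slope g v)).
    by apply: (cvg_pair (f:=cst x) (G:=nbhs x) (H:=nbhs (0:R)));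
      [exact: cvg_cst|exact: cal0].
  exact: continuous_slope dv cv.
have cG : G t @[t --> (0 : R)] --> 'D_w g x.
  have -> : 'D_w g x = slope g w (x, 0) by rewrite /slope /= eqxx.
  apply: (cvg_comp (fun t => (x + al t *: v, be t)) (slope g w)).
  apply: (cvg_pair (f:=fun t => x + al t *: v) (G:=nbhs x) (H:=nbhs (0:R)));
    last exact: cbe0.
  have {2}-> : x = x + al 0 *: v by rewrite al0 scale0r addr0.
  by apply: (cvgD (f:=cst x)); [exact: cvg_cst|apply: cvgZr_tmp; exact: cal].
  exact: continuous_slope dw cw.
have E : (fun h : R => h^-1 *:
     (((fun t => g (x + al t *: v + be t *: w)) \o shift 0) (h *: (1 : R))
     - g (x + al 0 *: v + be 0 *: w))) =
   (fun h : R => h^-1 *: ((al \o shift 0) (h *: (1:R)) - al 0) * F h +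
       h^-1 *: ((be \o shift 0) (h *: (1:R)) - be 0) * G h).
  apply/funext => h /=; rewrite ![h%:A]mulr1 !addr0.
  rewrite al0 be0 !scale0r !addr0 slopeE -/(G h) slopeE -/(F h) !subr0.
  by rewrite /GRing.scale /=; ring.
have lim : h^-1 *: ((al \o shift 0) (h *: (1:R)) - al 0) * F h +
       h^-1 *: ((be \o shift 0) (h *: (1:R)) - be 0) * G h @[h --> 0^'] -->
   a * 'D_v g x + b * 'D_w g x.
  apply: cvgD; apply: cvgM.
  - by case: dal => d <-; exact: d.
  - exact: cvg_within_filter cF.
  - by case: dbe => d <-; exact: d.
  - exact: cvg_within_filter cG.
rewrite -E in lim.
by split; [apply/cvg_ex; eexists; exact: lim|apply: cvg_lim lim].
Qed.

End PathDerivative.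

Section RowDerivative.
Variables (R : realType) (V : normedModType R).

Lemma is_derive_coord q (F : V -> 'rV[R]_q) x v dF j :
  is_derive x v F dF -> is_derive x v (fun z => F z 0 j) (dF 0 j).
Proof.
move=> [dx <-]; have dj := (derivable_mxP _ _ _).1 dx 0 j.
by split=> //; rewrite derive_mx // mxE.
Qed.

Lemma is_derive_rowP q (F : V -> 'rV[R]_q) x v (dF : 'rV[R]_q) :
  (forall j, is_derive x v (fun z => F z 0 j) (dF 0 j)) -> is_derive x v F dF.
Proof.
move=> h; have dx : derivable F x v.
  by apply/derivable_mxP => i j; rewrite (ord1 i); case: (h j).
split=> //; rewrite derive_mx //; apply/matrixP => i j.
by rewrite mxE (ord1 i); case: (h j).
Qed.

Lemma is_derive_dot q (F G : V -> 'rV[R]_q) x v dF dG :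
  is_derive x v F dF -> is_derive x v G dG ->
  is_derive x v (fun z => dot (F z) (G z)) (dot (F x) dG + dot dF (G x)).
Proof.
move=> hF hG.
have -> : (fun z => dot (F z) (G z)) =
    \sum_(i < q) ((fun z => F z 0 i) * (fun z => G z 0 i) : V -> R).
  by apply/funext => z; rewrite fct_sumE.
have h i := is_deriveM (is_derive_coord i hF) (is_derive_coord i hG).
have := is_derive_sum h => hs; apply: (is_derive_eq hs).
rewrite /dot -big_split; apply: eq_bigr => i _ /=.
by rewrite /GRing.scale /= [X in _ + X]mulrC.
Qed.

End RowDerivative.

Section ContinuouslyDifferentiable.
Variables (R : realType) (p q : nat) (U : set 'rV[R]_p.+1).
Variables (f : 'rV[R]_p.+1 -> 'rV[R]_q.+1) (x : 'rV[R]_p.+1).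
Hypotheses (oU : open U) (cU : class_C 1 U f) (Ux : U x).

Lemma class_C1_derivable z v : U z -> derivable f z v.
Proof. by move=> Uz; case: cU => _ /(_ v)[/(_ z Uz)]. Qed.

Lemma class_C1_near v j :
  \forall z \near x, derivable (fun z => f z 0 j) z v.
Proof.
have : \forall z \near x, U z by exact: open_nbhs_nbhs.
apply: filterS => z Uz.
by have /derivable_mxP h := @class_C1_derivable z v Uz; exact: (h 0 j).
Qed.

Lemma class_C1_cont v j :
  {for x, continuous (fun z => 'D_v (fun z => f z 0 j) z)}.
Proof.
have c : {for x, continuous (fun z => 'D_v f z 0 j)}.
  case: cU => _ /(_ v)[_ [/(_ x Ux) c _]].
  apply: (@continuous_comp _ _ _ (fun z => 'D_v f z)
    (fun y : 'rV[R]_q.+1 => y 0 j)) => //.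
  exact: coord_continuous.
have E : {near x, (fun z => 'D_v f z 0 j) =1
    (fun z => 'D_v (fun z => f z 0 j) z)}.
  have : \forall z \near x, U z by exact: open_nbhs_nbhs.
  apply: filterS => z Uz.
  by rewrite derive_mx ?mxE //; exact: class_C1_derivable.
move: c; rewrite /prop_for /continuous_at (nbhs_singleton E).
move=> c1; apply: cvg_trans c1.
by apply: near_eq_cvg E; exact: nbhs_filter.
Qed.

Lemma is_derive_class_C1_path v w (al be : R -> R) (a b : R) :
  al 0 = 0 -> be 0 = 0 -> is_derive (0 : R) (1 : R) al a ->
  is_derive (0 : R) (1 : R) be b ->
  is_derive (0 : R) (1 : R) (fun t => f (x + al t *: v + be t *: w))
    (a *: 'D_v f x + b *: 'D_w f x).
Proof.
move=> al0 be0 dal dbe; apply: is_derive_rowP => j.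
have := is_derive_path (class_C1_near v j) (class_C1_near w j)
  (class_C1_cont (v:=v) (j:=j)) (class_C1_cont (v:=w) (j:=j)) al0 be0 dal dbe.
by move/is_derive_eq; apply; rewrite !derive_mx ?mxE //; exact: class_C1_derivable.
Qed.

(** The path t |-> x + (a t) v + t w is the line in direction a v + w, so its
derivative can be computed in two ways. *)
Lemma derive_linear_direction a v w :
  'D_(a *: v + w) f x =
    a *: ('D_v f x : 'rV[R]_q.+1) + 'D_w f x :> 'rV[R]_q.+1.
Proof.
have d1 : is_derive (0 : R) (1 : R) (fun t : R => a * t) a.
  have := is_deriveZ a (is_derive_id (0 : R) (1 : R)).
  by move/is_derive_eq; apply; rewrite [LHS]mulr1.
have := is_derive_class_C1_path (be := id) v w (mulr0 a) erefl d1
  (is_derive_id (0 : R) (1 : R)).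
rewrite scale1r => -[_ <-].
have dU : derivable f (x + (0 : R) *: (a *: v + w)) (a *: v + w).
  by rewrite scale0r addr0; exact: class_C1_derivable.
have [_] := is_derive_line dU; rewrite scale0r addr0 => <-.
congr (derive _ 0 (1 : R)); apply/funext => t.
by rewrite scalerDr scalerA mulrC addrA.
Qed.

End ContinuouslyDifferentiable.

(** * Embedded spheres in great spheres *)

Section GreatCircle.
Variables (R : realType) (k : nat).
Implicit Types x v : 'rV[R]_k.+1.

Lemma dot_cos_sin x v (t s : R) : dot x x = 1 -> dot v v = 1 -> dot x v = 0 ->
  dot (cos t *: x + sin t *: v) (cos s *: x + sin s *: v) = cos (t - s).
Proof.
by move=> xx vv xv; rewrite !dotD (dotC v x) xx vv xv cosB; ring.
Qed.

Lemma great_circle_sphere x v (t : R) :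
  dot x x = 1 -> dot v v = 1 -> dot x v = 0 ->
  sphere (cos t *: x + sin t *: v).
Proof. by move=> xx vv xv; rewrite /sphere /= dot_cos_sin // subrr cos0. Qed.

(** The great circle may be restarted at any of its points, which reduces
derivatives along it to derivatives at time 0. *)
Lemma great_circleD x v (t h : R) :
  cos (h + t) *: x + sin (h + t) *: v =
  cos h *: (cos t *: x + sin t *: v) + sin h *: (- sin t *: x + cos t *: v).
Proof.
apply/rowP => i; rewrite !mxE cosD sinD; ring.
Qed.

End GreatCircle.

Section EmbeddedTangent.
Variables (R : realType) (k n : nat) (f : 'rV[R]_k.+1 -> 'rV[R]_n.+1).
Variable U : set 'rV[R]_k.+1.
Hypotheses (oU : open U) (sU : sphere (n := k) `<=` U) (cU : class_C 1 U f).

Lemma is_derive_great_circle x v :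
  dot x x = 1 -> dot v v = 1 ->
  is_derive (0 : R) (1 : R) (fun t => f (cos t *: x + sin t *: v)) ('D_v f x).
Proof.
move=> xx vv; have Ux : U x by exact: sU.
have dc : is_derive (0 : R) (1 : R) (fun t : R => cos t - 1) 0.
  have := is_deriveB (is_derive_cos (0 : R)) (is_derive_cst (1 : R) 0 (1 : R)).
  by move/is_derive_eq; apply; rewrite sin0 subr0 oppr0.
have ds : is_derive (0 : R) (1 : R) (@sin R) 1.
  by apply: (is_derive_eq (is_derive_sin (0 : R))); rewrite cos0.
have c0 : cos (0 : R) - 1 = 0 by rewrite cos0 subrr.
have := is_derive_class_C1_path oU cU Ux x v c0 (sin0 R) dc ds.
rewrite scale0r add0r scale1r.
rewrite (_ : (fun t : R => _) = (fun t => f (cos t *: x + sin t *: v))) //.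
apply/funext => t; congr (f (_ + _)).
by rewrite scalerBl scale1r addrC subrK.
Qed.

(** The function t |-> [dot y (f (cos t x + sin t v))] has a maximum at 0. *)
Lemma tangent_critical_unit x v y :
  dot x x = 1 -> dot v v = 1 -> dot x v = 0 ->
  (forall z, sphere z -> dot y (f z) <= dot y (f x)) ->
  dot y ('D_v f x) = 0.
Proof.
move=> xx vv xv ymax.
pose g (t : R) := dot y (f (cos t *: x + sin t *: v)).
have dg x' v' : dot x' x' = 1 -> dot v' v' = 1 ->
    is_derive (0 : R) (1 : R) (fun t => dot y (f (cos t *: x' + sin t *: v')))
      (dot y ('D_v' f x')).
  move=> xx' vv'.
  have := is_derive_dot (is_derive_cst y (0 : R) (1 : R))
    (is_derive_great_circle xx' vv').
  by move/is_derive_eq; apply; rewrite dot0l addr0.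
have dgt t : derivable g t 1.
  apply/derivable1P.
  have -> : (fun h : R => g (h *: (1 : R) + t)) = (fun h =>
    dot y (f (cos h *: (cos t *: x + sin t *: v) +
              sin h *: (- sin t *: x + cos t *: v)))).
    by apply/funext => h; rewrite [_%:A]mulr1 /g great_circleD.
  apply: ex_derive; apply: dg; first exact: great_circle_sphere.
  by rewrite !dotD (dotC v) xx vv xv; have := cos2Dsin2 t; lra.
have [_ <-] := dg x v xx vv.
have c0 : (0 : R) \in `]-1, 1[ by rewrite in_itv /= ltrN10 ltr01.
have ab : (-1 : R) <= 1 by lra.
have max t : t \in `]-1, 1[ -> g t <= g 0.
  move=> _; rewrite /g cos0 sin0 scale1r scale0r addr0.
  by apply: ymax; exact: great_circle_sphere.
by case: (derive1_at_max ab (fun t _ => dgt t) c0 max).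
Qed.

(** Every fact about tangent images comes from this one: they lie in the span of
the image, they are orthogonal to f(x), and they are orthogonal to y at a
maximum of [dot y (f _)]. *)
Lemma tangent_critical x v y :
  dot x x = 1 -> dot x v = 0 ->
  (forall z, sphere z -> dot y (f z) <= dot y (f x)) ->
  dot y ('D_v f x) = 0.
Proof.
move=> xx xv ymax; have [->|v0] := eqVneq v 0.
  by rewrite derive0 dot0r.
pose r := enorm v.
have r0 : r != 0 by rewrite gt_eqF // enorm_gt0.
have rr : r * r = dot v v := enorm_sqr v.
have -> : v = r *: (r^-1 *: v) + 0 by rewrite scalerA mulfV // scale1r addr0.
rewrite (derive_linear_direction oU cU (sU xx)) derive0 addr0 dotZr.
have v1 : dot (r^-1 *: v) (r^-1 *: v) = 1.
  by rewrite dotZl dotZr -rr mulrA -invfM mulVf // mulf_neq0.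
have xv1 : dot x (r^-1 *: v) = 0 by rewrite dotZr xv mulr0.
by rewrite (tangent_critical_unit xx v1 xv1 ymax) mulr0.
Qed.

End EmbeddedTangent.

Lemma linear_mulmx (R : realType) a b (F : 'rV[R]_a -> 'rV[R]_b) :
  (forall c u v, F (c *: u + v) = c *: F u + F v) ->
  exists M, forall v, F v = v *m M.
Proof.
move=> lF; pose hb := GRing.isLinear.Build R _ _ *:%R F lF.
pose L : {linear 'rV[R]_a -> 'rV[R]_b} := HB.pack F hb.
by exists (lin1_mx L) => v; rewrite mul_rV_lin1.
Qed.

(** For a point x of the parameter sphere, consider the linear map that sends a
tangent vector v to D_v f(x) and x itself to f(x). It takes values in P; it is
injective, because f is an immersion and f(x) is orthogonal to the tangent
image. Hence dim P >= k + 1. In case of equality it is onto P, and the inverse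
function theorem can be replaced by looking at a maximum of [dot y (f _)]. *)
Lemma embedded_sphere_span (R : realType) (k n : nat) (A : set 'rV[R]_n.+1)
    (P : {vspace 'rV[R]_n.+1}) :
  embedded_sphere k A -> (forall a, A a -> a \in P) ->
  (k.+1 <= \dim P)%N /\
  (\dim P = k.+1 -> forall y, dot y y = 1 -> y \in P -> A y).
Proof.
move=> [As [f [[[U [oU sU fC]] finj fimm] AE]]] AP.
have cU := fC 1%N.
have fS z : sphere z -> dot (f z) (f z) = 1.
  by move=> sz; apply: As; rewrite AE; exists z.
have fP z : sphere z -> f z \in P by move=> sz; apply: AP; rewrite AE; exists z.
(* for y orthogonal to P, dot y (f _) vanishes identically *)
have DP x v : dot x x = 1 -> dot x v = 0 -> 'D_v f x \in P.
  move=> xx xv; apply: mem_orthogonalP => y yP.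
  apply: (tangent_critical oU sU cU xx xv) => z sz.
  by rewrite !yP ?fP.
(* dot (f x) (f _) is at most 1, with equality at x *)
have Df x v : dot x x = 1 -> dot x v = 0 -> dot (f x) ('D_v f x) = 0.
  move=> xx xv; apply: (tangent_critical oU sU cU xx xv) => z sz.
  have /andP[_] := dot_unit_itv (fS x xx) (fS z sz).
  by rewrite (fS x xx).
have frame x : dot x x = 1 -> exists M : 'M[R]_(k.+1, n.+1),
    [/\ lker (linfun (mulmxr M : 'rV[R]_k.+1 -> 'rV[R]_n.+1)) == 0%VS,
     (limg (linfun (mulmxr M : 'rV[R]_k.+1 -> 'rV[R]_n.+1)) <= P)%VS &
     forall v, v *m M = 'D_(v - dot v x *: x) f x + dot v x *: f x].
  move=> xx; pose F v := 'D_(v - dot v x *: x) f x + dot v x *: f x.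
  have lF c u v : F (c *: u + v) = c *: F u + F v.
    rewrite /F dotDl dotZl.
    have -> : c *: u + v - (c * dot u x + dot v x) *: x =
        c *: (u - dot u x *: x) + (v - dot v x *: x).
      by apply/rowP => i; rewrite !mxE; ring.
    rewrite (derive_linear_direction oU cU (sU _ xx)) scalerDr scalerDl scalerA.
    by rewrite -!addrA; congr (_ + _); rewrite addrCA.
  have [M FE] := linear_mulmx lF; exists M.
  have tg v : dot x (v - dot v x *: x) = 0.
    by rewrite dotBr dotZr xx mulr1 dotC subrr.
  split; last by move=> v; rewrite -FE.
    apply/lker0P => u v; rewrite !lfunE /= => /eqP.
    rewrite -subr_eq0 -mulmxBl -FE => /eqP.
    set w := u - v; rewrite /F => w0.
    have wx : dot w x = 0.
      have := congr1 (dot (f x)) w0.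
      by rewrite dotDr Df // dotZr fS // dot0r add0r mulr1.
    move: w0; rewrite wx !scale0r subr0 addr0 => w0.
    apply/eqP; rewrite -subr_eq0; apply/negPn/negP => wn0.
    by have := fimm x w xx; rewrite dotC wx w0 eqxx => /(_ erefl wn0).
  apply/subvP => _ /memv_imgP[v _ ->]; rewrite lfunE /= -FE /F.
  by rewrite memvD ?DP // memvZ // fP.
have ee := delta_sphere R k.
split.
  have [M [kM iM _]] := frame _ ee.
  apply: leq_trans (dimvS iM); rewrite limg_dim_eq ?(eqP kM) ?capv0 //.
  by rewrite dimvf /dim /= mul1n.
move=> dP y yy yP.
have [x sx ymax] : exists2 x, sphere x &
    forall z, sphere z -> dot y (f z) <= dot y (f x).
  have cf : {within sphere (n := k), continuous (fun z => dot y (f z))}.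
    apply: continuous_in_subspaceT => z /set_mem sz.
    apply: continuous_dot; first exact: cst_continuous.
    by case: (fC 0%N) => c _; apply: c; exact: sU.
  have ne : sphere (R := R) (n := k) !=set0 by exists (delta_mx 0 0).
  have [x /set_mem sx xm] := EVT_max_rV ne (@sphere_compact R k) cf.
  by exists x => // z sz; apply: xm; exact: mem_set.
have xx : dot x x = 1 := sx.
have [M [kM iM ME]] := frame x xx.
have surj z : z \in P -> exists v, z = v *m M.
  have <- : limg (linfun (mulmxr M : 'rV[R]_k.+1 -> 'rV[R]_n.+1)) = P.
    apply/eqP; rewrite eqEdim iM dP limg_dim_eq ?(eqP kM) ?capv0 //.
    by rewrite dimvf /dim /= mul1n.
  by move=> /memv_imgP[v _ ->]; exists v; rewrite lfunE.
(* z is the component of y in the tangent image, where y is critical *)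
pose c := dot y (f x).
pose z := y - c *: f x.
have zf : dot z (f x) = 0 by rewrite dotBl dotZl fS // mulr1 subrr.
have z0 : z = 0.
  have [|v zE] := surj z; first by rewrite memvB // memvZ // fP.
  have tg : dot x (v - dot v x *: x) = 0.
    by rewrite dotBr dotZr xx mulr1 dotC subrr.
  apply/eqP; rewrite -dot_eq0 {2}zE ME dotDr dotZr zf mulr0 addr0.
  rewrite dotBl dotZl Df // mulr0 subr0.
  by apply/eqP; exact: (tangent_critical oU sU cU xx tg).
have yE : y = c *: f x by apply/eqP; rewrite -subr_eq0 -/z z0.
have cc : c * c = 1 by move: yy; rewrite yE dotZl dotZr fS // mulr1.
have : (c - 1) * (c + 1) == 0 by rewrite -subr_sqr expr1n expr2 cc subrr.
rewrite mulf_eq0 subr_eq0 addr_eq0 => /orP[]/eqP c1.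
  by rewrite AE; exists x => //; rewrite yE c1 scale1r.
(* the maximum of dot y (f _) is -1, its least possible value, so f is constant
   and identifies x with -x *)
have fconst w : sphere w -> f w = - y.
  move=> sw; apply/eqP; rewrite -addr_eq0 -dot_eq0 !dotD (dotC _ y) yy fS //.
  have /andP[lo _] := dot_unit_itv yy (fS w sw).
  have hi : dot y (f w) <= -1 by rewrite -c1; exact: ymax.
  by apply/eqP; lra.
have sNx : sphere (- x) by rewrite /sphere /= dotNl dotNr opprK.
have /eqP := finj x (- x) sx sNx (etrans (fconst x sx) (esym (fconst _ sNx))).
rewrite -addr_eq0 -mulr2n -scaler_nat scaler_eq0 pnatr_eq0 /= => /eqP x0.
by move: xx; rewrite x0 dot0l => /eqP; rewrite eq_sym oner_eq0.
Qed.

(** * Smooth maps *)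

(** The class C^r on the whole space, with an arbitrary normed codomain: scalar
factors and vector-valued maps are then covered by the same closure lemmas. *)
Fixpoint Cr (R : realType) (r : nat) (V W : normedModType R) (f : V -> W) :
    Prop :=
  continuous f /\
  match r with
  | 0%N => True
  | r'.+1 => forall v, (forall x, derivable f x v) /\ Cr r' (fun x => 'D_v f x)
  end.

Section Cr.
Variables (R : realType) (V : normedModType R).

Lemma Cr_continuous r (W : normedModType R) (f : V -> W) :
  Cr r f -> continuous f.
Proof. by case: r => [|r] []. Qed.

(** The closure lemmas below all follow this pattern: exhibit the directional
derivatives, and observe that they are built from maps of class C^r. *)
Lemma Cr_step r (W : normedModType R) (f : V -> W) (df : V -> V -> W) :
  continuous f -> (forall v x, is_derive x v f (df v x)) ->
  (forall v, Cr r (df v)) -> Cr r.+1 f.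
Proof.
move=> cf hf hdf; split=> // v; split=> [x|]; first by case: (hf v x).
have -> : (fun x => 'D_v f x) = df v; last exact: hdf.
by apply/funext => x; case: (hf v x).
Qed.

Lemma Cr_derive r (W : normedModType R) (f : V -> W) v x :
  Cr r.+1 f -> is_derive x v f ('D_v f x).
Proof. by case=> _ /(_ v)[/(_ x)]. Qed.

Lemma Cr_pred r (W : normedModType R) (f : V -> W) : Cr r.+1 f -> Cr r f.
Proof.
elim: r f => [|r IH] f [cf df]; first by split.
by split=> // v; have [dv Cv] := df v; split=> //; exact: IH.
Qed.

Lemma Cr_cst r (W : normedModType R) (a : W) : Cr r (cst a : V -> W).
Proof.
elim: r a => [|r IH] a; first by split=> //; exact: cst_continuous.
apply: (@Cr_step _ _ _ (fun _ => cst 0)) => //; exact: cst_continuous.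
Qed.

Lemma Cr_add r (W : normedModType R) (f g : V -> W) :
  Cr r f -> Cr r g -> Cr r (fun x => f x + g x).
Proof.
elim: r f g => [|r IH] f g hf hg.
  by split=> // x; apply: cvgD;
    [exact: (Cr_continuous hf)|exact: (Cr_continuous hg)].
apply: (@Cr_step _ _ _ (fun v x => 'D_v f x + 'D_v g x)).
- by move=> x; apply: cvgD;
    [exact: (Cr_continuous hf)|exact: (Cr_continuous hg)].
- by move=> v x; exact: is_deriveD (Cr_derive v x hf) (Cr_derive v x hg).
- by move=> v; apply: IH; [case: hf => _ /(_ v)[]|case: hg => _ /(_ v)[]].
Qed.

Lemma is_derive_scale (W : normedModType R) (g : V -> R) (F : V -> W) x v dg dF :
  {for x, continuous F} -> is_derive x v g dg -> is_derive x v F dF ->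
  is_derive x v (fun z => g z *: F z) (dg *: F x + g x *: dF).
Proof.
move=> cF [gx <-] [Fx <-].
have cFv : F (h *: v + x) @[h --> (0 : R)^'] --> F x.
  have : h *: v + x @[h --> (0 : R)] --> (0 : R) *: v + x.
    by apply: (cvgD (g := cst x)); [apply: cvgZr_tmp; exact: cvg_id|exact: cvg_cst].
  rewrite scale0r add0r => hx.
  apply: cvg_within_filter.
  by apply: (cvg_comp (fun h : R => h *: v + x) F); [exact: hx|exact: cF].
have E : (fun h : R => h^-1 *: (((fun z => g z *: F z) \o shift x) (h *: v)
     - g x *: F x)) =
   (fun h : R => (h^-1 *: ((g \o shift x) (h *: v) - g x)) *: F (h *: v + x) +
      g x *: (h^-1 *: ((F \o shift x) (h *: v) - F x))).
  apply/funext => h /=.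
  set y := h *: v + x; set i := h^-1.
  have -> : (i *: (g y - g x)) *: F y = i *: ((g y - g x) *: F y).
    by rewrite [RHS]scalerA.
  have -> : g x *: (i *: (F y - F x)) = i *: (g x *: (F y - F x)).
    by rewrite !scalerA mulrC.
  rewrite -scalerDr; congr (i *: _).
  by rewrite scalerBl scalerBr addrA subrK.
have lim : (h^-1 *: ((g \o shift x) (h *: v) - g x)) *: F (h *: v + x) +
      g x *: (h^-1 *: ((F \o shift x) (h *: v) - F x)) @[h --> 0^'] -->
   'D_v g x *: F x + g x *: 'D_v F x.
  by apply: cvgD; [apply: cvgZ; [exact: gx|exact: cFv]|apply: cvgZl_tmp; exact: Fx].
rewrite -E in lim.
by split; [apply/cvg_ex; eexists; exact: lim|apply: cvg_lim lim].
Qed.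

Lemma Cr_scale r (W : normedModType R) (g : V -> R) (F : V -> W) :
  Cr r g -> Cr r F -> Cr r (fun x => g x *: F x).
Proof.
have cgF (g' : V -> R) (F' : V -> W) r' : Cr r' g' -> Cr r' F' ->
    continuous (fun x => g' x *: F' x).
  by move=> hg hF x; apply: cvgZ;
    [exact: (Cr_continuous hg)|exact: (Cr_continuous hF)].
elim: r g F => [|r IH] g F hg hF; first by split=> //; exact: cgF hg hF.
apply: (@Cr_step _ _ _ (fun v x => 'D_v g x *: F x + g x *: 'D_v F x)).
- exact: cgF hg hF.
- move=> v x; apply: is_derive_scale (Cr_derive v x hg) (Cr_derive v x hF).
  exact: (Cr_continuous hF).
- move=> v; apply: Cr_add; apply: IH; try exact: Cr_pred;
    by [case: hg => _ /(_ v)[]|case: hF => _ /(_ v)[]].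
Qed.

Lemma Cr_dot r q (F G : V -> 'rV[R]_q) :
  Cr r F -> Cr r G -> Cr r (fun x => dot (F x) (G x) : R).
Proof.
have cFG (F' G' : V -> 'rV[R]_q) r' : Cr r' F' -> Cr r' G' ->
    continuous (fun x => dot (F' x) (G' x)).
  by move=> hF hG x; apply: continuous_dot;
    [exact: (Cr_continuous hF)|exact: (Cr_continuous hG)].
elim: r F G => [|r IH] F G hF hG; first by split=> //; exact: cFG hF hG.
apply: (@Cr_step _ _ _ (fun v x => dot (F x) ('D_v G x) + dot ('D_v F x) (G x))).
- exact: cFG hF hG.
- by move=> v x; exact: is_derive_dot (Cr_derive v x hF) (Cr_derive v x hG).
- move=> v; apply: Cr_add; apply: IH; try exact: Cr_pred;
    by [case: hG => _ /(_ v)[]|case: hF => _ /(_ v)[]].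
Qed.

Definition rsqrt (a : R) : R := (Num.sqrt a)^-1.

Lemma rsqrt_gt0 (a : R) : 0 < a -> 0 < rsqrt a.
Proof. by move=> a0; rewrite invr_gt0 sqrtr_gt0. Qed.

Lemma rsqrt_sqr (a : R) : 0 < a -> rsqrt a * rsqrt a * a = 1.
Proof.
move=> a0; rewrite /rsqrt -invfM -expr2 sqr_sqrtr ?ltW // mulVf //.
by rewrite gt_eqF.
Qed.

(** Reduces a directional derivative to one in a real variable, where the chain
rule for real functions applies. *)
Lemma is_derive_along (W : normedModType R) (f : V -> W) x v d :
  is_derive x v f d <-> is_derive (0 : R) (1 : R) (fun h => f (h *: v + x)) d.
Proof.
have E : (fun h : R => h^-1 *: ((f \o shift x) (h *: v) - f x)) =
  (fun h : R => h^-1 *: (((fun h => f (h *: v + x)) \o shift (0 : R)) (h *: (1 : R))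
    - f ((0 : R) *: v + x))).
  by apply/funext => h /=; rewrite [h%:A]mulr1 addr0 scale0r add0r.
by split=> -[dx dv]; split; move: dx dv; rewrite /derivable /derive E.
Qed.

Lemma is_derive_rsqrt (w : V -> R) x v dw : 0 < w x -> is_derive x v w dw ->
  is_derive x v (fun z => rsqrt (w z)) (- 2^-1 * rsqrt (w x) ^+ 3 * dw).
Proof.
move=> w0 /is_derive_along dw0; apply/is_derive_along.
have w0' : 0 < w ((0 : R) *: v + x) by rewrite scale0r add0r.
have ds := is_derive1_comp (is_derive1_sqrt w0') dw0.
have s0 : Num.sqrt (w ((0 : R) *: v + x)) != 0 by rewrite gt_eqF // sqrtr_gt0.
have := is_deriveV (f := Num.sqrt \o (fun h : R => w (h *: v + x))) s0 ds.
move/is_derive_eq; apply; rewrite /= scale0r add0r /rsqrt.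
have : Num.sqrt (w x) != 0 by rewrite gt_eqF // sqrtr_gt0.
by move: (Num.sqrt (w x)) => s sN0; rewrite /GRing.scale /=; field.
Qed.

(** The derivative of w^(-1/2) is -1/2 (w^(-1/2))^3 D_v w: only the function
itself and the derivative of w occur, so that induction on r applies. *)
Lemma Cr_rsqrt r (w : V -> R) : (forall x, 0 < w x) ->
  Cr r w -> Cr r (fun x => rsqrt (w x)).
Proof.
move=> w0.
have cw r' : Cr r' w -> continuous (fun x => rsqrt (w x)).
  move=> hw x; apply: cvgV; first by rewrite gt_eqF // sqrtr_gt0.
  apply: (@continuous_comp _ _ _ w (@Num.sqrt R)).
    exact: (Cr_continuous hw).
  exact: sqrt_continuous.
elim: r => [|r IH] hw; first by split=> //; exact: cw hw.
apply: (@Cr_step _ _ _ (fun v x => - 2^-1 * rsqrt (w x) ^+ 3 * 'D_v w x)).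
- exact: cw hw.
- by move=> v x; exact: is_derive_rsqrt (w0 x) (Cr_derive v x hw).
- move=> v.
  have hr := IH (Cr_pred hw).
  have hD : Cr r ('D_v w) by case: hw => _ /(_ v)[].
  (* on R, scaling is multiplication: the product below is the derivative *)
  have := Cr_scale (Cr_scale (Cr_cst r (- 2^-1 : R))
    (Cr_scale hr (Cr_scale hr hr))) hD.
  congr (Cr r _).
Qed.

End Cr.

Lemma Cr_coord (R : realType) r a i :
  Cr r (fun u : 'rV[R]_a => u 0 i : R).
Proof.
have c : continuous (fun u : 'rV[R]_a => u 0 i : R) by exact: coord_continuous.
case: r => [|r]; first by split.
have h v x := is_derive_coord i (is_derive_id (x : 'rV[R]_a) v).
by apply: (Cr_step c h) => v; exact: Cr_cst.
Qed.

Lemma Cr_mulmx (R : realType) r a b (M : 'M[R]_(a, b)) :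
  Cr r (fun u : 'rV[R]_a => u *m M).
Proof.
have -> : (fun u : 'rV[R]_a => u *m M) = (fun u => \sum_i u 0 i *: row i M).
  by apply/funext => u; rewrite mulmx_sum_row.
elim: (index_enum _) => [|i s IH].
  under eq_fun do rewrite big_nil.
  exact: Cr_cst.
under eq_fun do rewrite big_cons.
apply: Cr_add IH; apply: Cr_scale; first exact: Cr_coord.
exact: Cr_cst.
Qed.

Lemma Cr_class_C (R : realType) r p q (f : 'rV[R]_p.+1 -> 'rV[R]_q.+1) :
  Cr r f -> class_C r setT f.
Proof.
elim: r f => [|r IH] f [cf df]; first by split=> // x _; exact: cf.
split=> [x _|v]; first exact: cf.
by have [dv Cv] := df v; split; [move=> x _; exact: dv|exact: IH].
Qed.

(** * Graphs over a great sphere *)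

Section Graph.
Variables (R : realType) (m : nat) (L : 'M[R]_(m.+1, m.+2)) (c : 'rV[R]_m.+2).
Hypotheses (LL : L *m L^T = 1%:M) (cL : c *m L^T = 0) (cc : dot c c = 1).
Variables (q : 'rV[R]_m.+1 -> R).
Hypothesis qC : forall r, Cr r q.

Lemma frame_dot u v : dot (u *m L) (v *m L) = dot u v.
Proof. by rewrite dot_mulmx -mulmxA LL mulmx1. Qed.

Lemma frame_orth u : dot (u *m L) c = 0.
Proof. by rewrite dot_mulmx cL dot0r. Qed.

Definition graph_scale (u : 'rV[R]_m.+1) : R := rsqrt (1 + q u * q u).

(** The rows of L are an orthonormal basis of the orthogonal complement of c, so
u |-> u L identifies the unit sphere of rows of length m + 1 with the great
sphere orthogonal to c. The graph of q is obtained by lowering the point u L by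
q u along c and normalising; its radial projection to the great sphere is u L
again. *)
Definition graph (u : 'rV[R]_m.+1) : 'rV[R]_m.+2 :=
  graph_scale u *: (u *m L - q u *: c).

Lemma graph_denom_gt0 u : 0 < 1 + q u * q u.
Proof. by rewrite ltr_pwDl // -expr2 sqr_ge0. Qed.

Lemma graph_scale_gt0 u : 0 < graph_scale u.
Proof. exact/rsqrt_gt0/graph_denom_gt0. Qed.

Lemma dot_graphc u : dot (graph u) c = - (graph_scale u * q u).
Proof. by rewrite dotZl dotBl frame_orth dotZl cc; ring. Qed.

Lemma graphL u : graph u *m L^T = graph_scale u *: u.
Proof.
by rewrite -scalemxAl mulmxBl -mulmxA LL mulmx1 -scalemxAl cL scaler0 subr0.
Qed.

Lemma graph_sphere u : sphere u -> sphere (graph u).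
Proof.
rewrite /sphere /= => uu; rewrite dotZl dotZr dotBl !dotBr !dotD frame_dot uu.
rewrite (dotC c) frame_orth cc; have := rsqrt_sqr (graph_denom_gt0 u).
by rewrite -/(graph_scale u) => h; rewrite -[RHS]h; ring.
Qed.

Lemma graph_Cr r : Cr r graph.
Proof.
have C1 : Cr r (fun u => 1 + q u *: (q u : R)).
  by apply: Cr_add; [exact: Cr_cst|exact: Cr_scale].
apply: Cr_scale; first exact: Cr_rsqrt graph_denom_gt0 C1.
have -> : (fun x => x *m L - q x *: c) = (fun x => x *m L + q x *: (- c)).
  by apply/funext => u; rewrite scalerN.
apply: Cr_add; first exact: Cr_mulmx.
by apply: Cr_scale => //; exact: Cr_cst.
Qed.

Lemma graph_embedded : embedded_sphere m (graph @` sphere (n := m)).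
Proof.
split; first by move=> _ [u su <-]; exact: graph_sphere.
exists graph; split=> //; split.
- exists setT; split=> // [|r]; first exact: openT.
  exact/Cr_class_C/graph_Cr.
- (* the projection recovers u up to the positive factor graph_scale u *)
  move=> u v su sv e; have := congr1 (fun x => x *m L^T) e.
  rewrite !graphL => e1.
  have e2 := congr1 (fun x => dot x x) e1; move: e2.
  rewrite !dotD su sv !mulr1 => e2.
  have e3 : graph_scale u = graph_scale v.
    have := graph_scale_gt0 u; have := graph_scale_gt0 v.
    have : (graph_scale u - graph_scale v) * (graph_scale u + graph_scale v) == 0.
      by rewrite -subr_sqr !expr2 e2 subrr.
    rewrite mulf_eq0 subr_eq0 => /orP[/eqP //|/eqP h] p1 p2; lra.
  move: e1; rewrite e3 => /scalerI; apply.
  by rewrite gt_eqF // graph_scale_gt0.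
- (* paired with v L, the derivative in a tangent direction v gives
     graph_scale x times |v|^2 *)
  move=> x v xx xv v0; apply/negP => /eqP D0.
  pose w := v *m L.
  have d1 : is_derive x v (fun z => dot (graph z) w) 0.
    have := is_derive_dot (Cr_derive v x (graph_Cr 1)) (is_derive_cst w x v).
    by move/is_derive_eq; apply; rewrite D0 dot0l dot0r addr0.
  have gC : Cr 1 graph_scale.
    apply: Cr_rsqrt graph_denom_gt0 _.
    by apply: Cr_add; [exact: Cr_cst|exact: Cr_scale].
  have d2 : is_derive x v (fun z => graph_scale z *: (dot z v : R))
      ('D_v graph_scale x *: (dot x v : R) + graph_scale x *: (dot v v : R)).
    apply: is_derive_scale.
    - by apply: continuous_dot => //; exact: cst_continuous.
    - exact: Cr_derive gC.
    - have := is_derive_dot (is_derive_id x v) (is_derive_cst v x v).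
      by move/is_derive_eq; apply; rewrite dot0r add0r.
  have E : (fun z => dot (graph z) w) = (fun z => graph_scale z *: (dot z v : R)).
    apply/funext => z; rewrite dotZl dotBl frame_dot dotZl (dotC c) frame_orth.
    by rewrite mulr0 subr0.
  move: d1; rewrite E => -[_ e1]; case: d2 => _; rewrite e1 xv scaler0 add0r.
  move/eqP; rewrite eq_sym mulf_eq0 dot_eq0 (negbTE v0) orbF.
  by rewrite gt_eqF // graph_scale_gt0.
Qed.

End Graph.

(** * The two sides of a graph *)

Section Sides.
Variables (R : realType) (m : nat) (L : 'M[R]_(m.+1, m.+2)) (c : 'rV[R]_m.+2).
Hypotheses (LL : L *m L^T = 1%:M) (cL : c *m L^T = 0) (cc : dot c c = 1).
Hypothesis frame : forall x, x = dot x c *: c + x *m L^T *m L.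
Variables (q : 'rV[R]_m.+1 -> R) (K : R).
Hypothesis qC : forall r, Cr r q.
Hypothesis qZ : forall t y, q (t *: y) = t ^+ 2 * q y.
Hypothesis qK : forall y, `|q y| <= K * dot y y.

(** The height over the graph of q, extended to all of space homogeneously of
degree one; at the poles, where the row x L^T is zero, the second summand is 0
because the inverse of 0 is 0. Homogeneity makes the function affine on segments
that end at a pole, see [side_toward_pole]. *)
Definition side (x : 'rV[R]_m.+2) : R :=
  dot x c + q (x *m L^T) * (enorm (x *m L^T))^-1.

Lemma sideZ t x : 0 <= t -> side (t *: x) = t * side x.
Proof.
move=> t0; rewrite /side dotZl -scalemxAl enormZ // qZ.
have [->|tn0] := eqVneq t 0; first by rewrite expr0n /= !mul0r addr0.
rewrite invfM; set i := (enorm _)^-1; field; exact: tn0.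
Qed.

Lemma side_toward_pole (t s : R) x : 0 <= t ->
  side (t *: x + s *: c) = t * side x + s.
Proof.
move=> t0; rewrite -sideZ // /side dotDl dotZl [dot (s *: c) c]dotZl cc.
by rewrite mulmxDl -[s *: c *m _]scalemxAl cL scaler0 addr0; ring.
Qed.

Lemma side0 : side 0 = 0.
Proof. by rewrite -[0](scale0r (0 : 'rV[R]_m.+2)) sideZ // mul0r. Qed.

Lemma side_pole s : side (s *: c) = s.
Proof.
by rewrite -[s *: c]add0r -[0](scale0r (0 : 'rV[R]_m.+2)) side_toward_pole //
  mul0r add0r.
Qed.

(** Away from the axis of c this is clear; on the axis, |q y| / |y| <= K |y|. *)
Lemma continuous_side : continuous side.
Proof.
have cq : continuous (fun y : 'rV[R]_m.+1 => q y * (enorm y)^-1).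
  move=> y; have [->|y0] := eqVneq y 0.
    rewrite /continuous_at enorm0 invr0 mulr0.
    have h : (K * enorm y : R) @[y --> (0 : 'rV[R]_m.+1)] --> (0 : R).
      have := @continuous_enorm R m.+1 0; rewrite /continuous_at enorm0 => ce.
      have := @cvgM _ _ _ _ (cst K) _ _ _ (cvg_cst K) ce.
      by rewrite mulr0; apply.
    have dom : \forall z \near (0 : 'rV[R]_m.+1),
        cst 0 z <= `|q z * (enorm z)^-1| <= K * enorm z.
      apply: (@filterE _ (nbhs (0 : 'rV[R]_m.+1))) => z.
      rewrite normr_ge0 /= normrM normfV.
      have [->|z0] := eqVneq z 0.
        by rewrite enorm0 normr0 invr0 !mulr0.
      have n0 : 0 < enorm z by rewrite enorm_gt0.
      rewrite (ger0_norm (ltW n0)) ler_pdivrMr // -mulrA enorm_sqr.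
      exact: qK.
    apply/norm_cvg0P; first exact: nbhs_filter.
    exact: (squeeze_cvgr dom (cvg_cst 0) h).
  have e0 : enorm y != 0 by rewrite gt_eqF // enorm_gt0.
  exact: (cvgM (@Cr_continuous _ _ _ _ _ (qC 0) y)
    (cvgV e0 (@continuous_enorm R _ y))).
have cL2 : continuous (fun x : 'rV[R]_m.+2 => x *m L^T).
  exact: (Cr_continuous (Cr_mulmx 0 L^T)).
move=> x.
have c1 : {for x, continuous (fun x : 'rV[R]_m.+2 => dot x c)}.
  by apply: continuous_dot => //; exact: cst_continuous.
have c2 : {for x, continuous (fun x : 'rV[R]_m.+2 =>
    q (x *m L^T) * (enorm (x *m L^T))^-1)}.
  apply: (@continuous_comp _ _ _ (fun x : 'rV[R]_m.+2 => x *m L^T)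
    (fun y => q y * (enorm y)^-1)); last exact: cq.
  exact: cL2.
exact: (cvgD c1 c2).
Qed.

Let S : set 'rV[R]_m.+2 := graph L c q @` sphere (n := m).

Lemma frame_dotxx x : dot x x = dot x c ^+ 2 + dot (x *m L^T) (x *m L^T).
Proof.
rewrite [X in dot X X]frame !dotD frame_dot // (dotC c) frame_orth // cc; ring.
Qed.

Lemma side_graph u : sphere u -> side (graph L c q u) = 0.
Proof.
rewrite /sphere /= => uu; rewrite /side dot_graphc // graphL //.
have r0 := graph_scale_gt0 q u; rewrite enormZ ?ltW // qZ.
rewrite /enorm uu sqrtr1; field; exact: lt0r_neq0.
Qed.

Lemma side_eq0 x : sphere x -> side x = 0 -> S x.
Proof.
rewrite /sphere /side /= => xx; set y := x *m L^T => h.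
have y0 : y != 0.
  apply/eqP => y0; move: h; rewrite y0 enorm0 invr0 mulr0 addr0 => s0.
  move: xx; rewrite frame_dotxx s0 -/y y0 dot0l expr0n addr0.
  by move/eqP; rewrite eq_sym oner_eq0.
set r := enorm y in h; have r0 : 0 < r by rewrite enorm_gt0.
pose u := r^-1 *: y.
have yE : y = r *: u by rewrite scalerA mulfV ?gt_eqF // scale1r.
have uu : dot u u = 1.
  rewrite dotZl dotZr -enorm_sqr -/r; field; exact: lt0r_neq0.
exists u => //.
have sE : dot x c = - (r * q u).
  have qy : q y * r^-1 = r * q u.
    by rewrite [in q y]yE qZ; field; exact: lt0r_neq0.
  by apply/eqP; rewrite -addr_eq0 -qy h.
have rr : graph_scale q u = r.
  have h1 := rsqrt_sqr (graph_denom_gt0 q u); rewrite -/(graph_scale q u) in h1.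
  have h2 : r * r * (1 + q u * q u) = 1.
    by rewrite -[RHS]xx frame_dotxx sE -/y -enorm_sqr -/r; ring.
  have r1 := graph_scale_gt0 q u.
  have h3 : graph_scale q u * graph_scale q u = r * r.
    apply: (mulIf (lt0r_neq0 (graph_denom_gt0 q u))); by rewrite h1 h2.
  have : (graph_scale q u - r) * (graph_scale q u + r) == 0.
    by rewrite -subr_sqr !expr2 h3 subrr.
  by rewrite mulf_eq0 subr_eq0 => /orP[/eqP //|/eqP h4]; lra.
have yL : y *m L = r *: (u *m L) by rewrite scalemxAl -yE.
by rewrite /graph rr [RHS]frame sE -/y yL scalerBr scalerA scaleNr addrC.
Qed.

Let X : set 'rV[R]_m.+2 := sphere (n := m.+1) `\` S.

Lemma compl_side x : sphere x -> side x != 0 -> X x.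
Proof.
move=> sx x0; split=> // -[u su E]; move: x0.
by rewrite -E side_graph // eqxx.
Qed.

Lemma pole_compl s : s * s = 1 -> X (s *: c).
Proof.
move=> ss; apply: compl_side.
  by rewrite /sphere /= !dotD cc mulr1.
rewrite side_pole; apply/eqP => s0; move: ss; rewrite s0 mulr0 => /eqP.
by rewrite eq_sym oner_eq0.
Qed.

(** For s = 1 or s = -1, the segment from x to the pole s c stays on one side by
[side_toward_pole]; its radial projection joins x to the pole in the complement
of the graph. *)
Lemma side_component s x : s * s = 1 -> sphere x -> 0 < s * side x ->
  connected_component X (s *: c) x.
Proof.
move=> ss sx hx.
pose g (t : R) := (1 - t) *: x + (t * s) *: c.
have gside t : t \in `[0, 1] -> side (g t) = (1 - t) * side x + t * s.
  by rewrite in_itv /= => /andP[t0 t1]; rewrite side_toward_pole // subr_ge0.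
have gpos t : t \in `[0, 1] -> 0 < s * side (g t).
  move=> t01; rewrite gside //; move: t01; rewrite in_itv /= => /andP[t0 t1].
  have -> : s * ((1 - t) * side x + t * s) = (1 - t) * (s * side x) + t * (s * s).
    by ring.
  rewrite ss mulr1; have [->|tn0] := eqVneq t 0.
    by rewrite subr0 mul1r addr0.
  rewrite ltr_wpDl //; first by rewrite mulr_ge0 ?subr_ge0 // ltW.
  by rewrite lt_def tn0.
have g0 t : t \in `[0, 1] -> 0 < dot (g t) (g t).
  move=> /gpos h; rewrite dot_gt0; apply/eqP => e; move: h.
  by rewrite e side0 mulr0 ltxx.
pose h t := rsqrt (dot (g t) (g t)) *: g t.
have cg : continuous g.
  move=> t; apply: cvgD; apply: cvgZr_tmp.
    by apply: cvgB; [exact: cvg_cst|exact: cvg_id].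
  by apply: cvgMr_tmp; exact: cvg_id.
have ch : {within `[0, 1], continuous h}.
  apply: continuous_in_subspaceT => t /set_mem /= t01.
  apply: cvgZ; last exact: cg.
  apply: cvgV; first by rewrite gt_eqF // sqrtr_gt0 g0.
  apply: (@continuous_comp _ _ _ (fun t => dot (g t) (g t)) (@Num.sqrt R)).
    by apply: continuous_dot; exact: cg.
  exact: sqrt_continuous.
have hX : h @` `[0, 1] `<=` X.
  move=> _ [t /= t01 <-]; have r0 := rsqrt_gt0 (g0 t t01).
  apply: compl_side.
    by rewrite /sphere /= dotZl dotZr mulrA rsqrt_sqr // g0.
  rewrite sideZ ?ltW //; apply: mulf_neq0; first by rewrite gt_eqF.
  by apply/eqP => e; have := gpos t t01; rewrite e mulr0 ltxx.
have h0 : h 0 = x.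
  rewrite /h /g subr0 scale1r mul0r scale0r addr0 sx /rsqrt sqrtr1 invr1.
  by rewrite scale1r.
have h1 : h 1 = s *: c.
  rewrite /h /g subrr scale0r mul1r add0r !dotD cc mulr1 ss.
  by rewrite /rsqrt sqrtr1 invr1 scale1r.
apply: (connected_component_max (B := h @` `[0, 1])) => //.
- by exists 1 => //=; rewrite in_itv /= ler01 lexx.
- apply: connected_continuous_connected ch; exact: segment_connected.
- by exists 0 => //=; rewrite in_itv /= ler01 lexx.
Qed.

(** On a connected set containing both poles, [side] would take the value 0. *)
Lemma poles_separated :
  connected_component X (1 *: c) <> connected_component X (-1 *: c).
Proof.
move=> E; pose C := connected_component X (1 *: c).
have C1 : C (1 *: c).
  by apply: connected_component_refl; apply: pole_compl; rewrite mulr1.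
have C2 : C (-1 *: c).
  rewrite /C E; apply: connected_component_refl; apply: pole_compl.
  by rewrite mulrNN mulr1.
have cC : connected (side @` C).
  apply: connected_continuous_connected; first exact: component_connected.
  exact: continuous_subspaceT continuous_side.
have /connected_intervalP itv := cC.
have [x Cx x0] : (side @` C) 0.
  apply: (itv (-1) 1).
  - by exists (-1 *: c) => //; rewrite side_pole.
  - by exists (1 *: c) => //; rewrite side_pole.
  - by rewrite lerN10 ler01.
have [sx] : X x := connected_component_sub Cx.
by apply; exact: side_eq0.
Qed.

Lemma side_unlinked (A B : set 'rV[R]_m.+2) :
  A `<=` sphere (n := m.+1) -> B `<=` sphere (n := m.+1) ->
  (forall a, A a -> 0 < side a) -> (forall b, B b -> side b < 0) ->
  unlinked A B.
Proof.
move=> sA sB hA hB.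
exists S, (connected_component X (1 *: c)), (connected_component X (-1 *: c)).
split.
- exact: graph_embedded.
- by exists (1 *: c) => //; apply: pole_compl; rewrite mulr1.
- by exists (-1 *: c) => //; apply: pole_compl; rewrite mulrNN mulr1.
- exact: poles_separated.
- split=> [a Aa|b Bb]; apply: side_component.
  + by rewrite mulr1.
  + exact: sA.
  + by rewrite mul1r hA.
  + by rewrite mulrNN mulr1.
  + exact: sB.
  + by rewrite mulN1r oppr_gt0 hB.
Qed.

End Sides.

(** * Orthonormal frames and dual cones *)

(** The Householder reflection that exchanges c and the first basis vector e:
1 - 2 w^T w / |w|^2 with w = c - e. *)
Lemma orthogonal_matrix_first_row (R : realType) m (c : 'rV[R]_m.+1) :
  dot c c = 1 -> exists H : 'M[R]_m.+1, H *m H^T = 1%:M /\ row 0 H = c.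
Proof.
move=> cc; pose e : 'rV[R]_m.+1 := delta_mx 0 0.
have ee : dot e e = 1 := delta_sphere R m.
have [ce|ce] := eqVneq c e.
  by exists 1%:M; rewrite trmx1 mulmx1 rowE mulmx1 ce.
have [w wE] : exists w, w = c - e by exists (c - e).
have ww : dot w w != 0 by rewrite dot_eq0 wE subr_eq0.
pose s := 2 / dot w w.
pose H := 1%:M - s *: (w^T *m w).
have wwE : w *m w^T = (dot w w)%:M.
  by apply/matrixP => i j; rewrite !ord1 dotE [RHS]mxE eqxx.
exists H; split.
  have -> : H^T = H.
    by rewrite /H linearB linearZ /= trmx1 trmx_mul trmxK.
  rewrite /H mulmxBl mul1mx mulmxBr mulmx1 -scalemxAl -scalemxAr.
  have -> : w^T *m w *m (w^T *m w) = dot w w *: (w^T *m w).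
    by rewrite mulmxA -(mulmxA w^T) wwE mul_mx_scalar -scalemxAl.
  rewrite !scalerA.
  have -> : s * s * dot w w = s + s by rewrite /s; field.
  by rewrite scalerDl; apply/matrixP => i j; rewrite !mxE; ring.
rewrite rowE -/e /H mulmxBr mulmx1 -scalemxAr mulmxA.
have -> : e *m w^T = (dot e w)%:M.
  by apply/matrixP => i j; rewrite !ord1 dotE [RHS]mxE eqxx.
rewrite mul_scalar_mx scalerA.
have ew : dot e w = - (dot w w / 2).
  by rewrite wE !dotBr !dotBl cc ee (dotC e c); field.
rewrite ew (_ : s * _ = -1); first by rewrite scaleN1r opprK wE addrC subrK.
by rewrite /s; field.
Qed.

Lemma orthonormal_frame (R : realType) m (c : 'rV[R]_m.+1) :
  dot c c = 1 -> exists L : 'M[R]_(m, m.+1),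
    [/\ L *m L^T = 1%:M, c *m L^T = 0 &
        forall x, x = dot x c *: c + x *m L^T *m L].
Proof.
move=> cc; have [H [HH Hc]] := orthogonal_matrix_first_row cc.
have HHE i j : dot (row i H) (row j H) = (i == j)%:R.
  have := congr1 (fun M : 'M[R]_m.+1 => M i j) HH.
  rewrite [RHS]mxE => <-; rewrite mxE.
  by apply: eq_bigr => k _; rewrite !mxE.
exists (\matrix_i row (lift ord0 i) H).
split.
- apply/matrixP => i j; rewrite [RHS]mxE -(inj_eq (@lift_inj _ ord0)) -HHE.
  by rewrite mxE; apply: eq_bigr => k _; rewrite !mxE.
- apply/matrixP => i j; rewrite ord1 [RHS]mxE.
  have <- : dot (row 0 H) (row (lift ord0 j) H) = 0 by rewrite HHE.
  by rewrite Hc mxE; apply: eq_bigr => k _; rewrite !mxE.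
- move=> x; have HH' : H^T *m H = 1%:M by exact: mulmx1C.
  rewrite -[LHS]mulmx1 -HH' mulmxA mulmx_sum_row big_ord_recl Hc.
  congr (_ *: _ + _).
    by rewrite -Hc dotE !mxE; apply: eq_bigr => k _; rewrite !mxE.
  rewrite [RHS]mulmx_sum_row; apply: eq_bigr => i _; rewrite rowK; congr (_ *: _).
  by rewrite !mxE; apply: eq_bigr => k _; rewrite !mxE.
Qed.

Lemma dot_mulmx_le (R : realType) a b (M : 'M[R]_(a, b)) :
  exists2 K, 0 <= K & forall y, dot (y *m M) (y *m M) <= K * dot y y.
Proof.
exists (\sum_j dot (col j M)^T (col j M)^T).
  by apply: sumr_ge0 => j _; exact: dot_ge0.
move=> y; rewrite /dot mulr_suml; apply: ler_sum => j _.
have -> : (y *m M) 0 j = dot y (col j M)^T.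
  by rewrite mxE; apply: eq_bigr => i _; rewrite !mxE.
by rewrite -expr2 mulrC; exact: dot_CS.
Qed.

Section DualCone.
Variables (R : realType) (m : nat) (A : set 'rV[R]_m).

Definition dual_cone : set 'rV[R]_m := [set x | forall a, A a -> 0 <= dot a x].

Lemma dual_cone_closed : closed dual_cone.
Proof.
have -> : dual_cone = \bigcap_(a in A) [set x | 0 <= dot a x].
  by apply/seteqP; split.
apply: closed_bigI => a _.
rewrite (_ : [set x | _] = (fun x => dot a x) @^-1` [set y | 0 <= y]) //.
apply: closed_comp; last exact: closed_ge.
by move=> x _; apply: continuous_dot => //; exact: cst_continuous.
Qed.

Lemma dual_coneD t x y : 0 <= t -> dual_cone x -> dual_cone y ->
  dual_cone (x + t *: y).
Proof.
by move=> t0 Kx Ky a Aa; rewrite dotDr dotZr addr_ge0 ?mulr_ge0 ?Kx ?Ky.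
Qed.

(** The variational inequality at a nearest point d. If [dot (p - d) x] were
positive, moving from d by t x with t = dot (p - d) x / |x|^2 would come closer
to p. *)
Lemma dual_cone_projection p : exists2 d, dual_cone d &
  forall x, dual_cone x -> dot (p - d) x <= 0.
Proof.
pose g x := dot (x - p) (x - p).
have cg : continuous g.
  have cp : continuous (fun x : 'rV[R]_m => x - p).
    by move=> x; exact: (cvgB cvg_id (cvg_cst p)).
  by move=> x; exact: (continuous_dot (cp x) (cp x)).
pose K := dual_cone `&` [set x | g x <= dot p p].
have K0 : K 0.
  split; first by move=> a _; rewrite dot0r.
  by rewrite /= /g sub0r dotNl dotNr opprK.
have cK : compact K.
  apply: (@compact_dot_le _ _ (4 * dot p p)).
    apply: closedI; first exact: dual_cone_closed.
    rewrite (_ : [set x | _] = g @^-1` [set y | y <= dot p p]) //.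
    by apply: closed_comp; [move=> x _; exact: cg|exact: closed_le].
  (* |x|^2 <= 2 |x - p|^2 + 2 |p|^2, by the parallelogram law *)
  move=> x [_ /=]; have := dot_ge0 (x - p - p).
  rewrite /g !dotBl !dotBr (dotC p x); lra.
have [d /set_mem [Kd dp] dmin] :=
  EVT_min_rV (ex_intro _ 0 K0) cK (continuous_subspaceT cg).
have dmin' x : dual_cone x -> g d <= g x.
  move=> Kx; have [xp|xp] := leP (g x) (dot p p).
    by apply: dmin; exact: mem_set.
  exact: le_trans dp (ltW xp).
exists d => // x Kx; rewrite leNgt; apply/negP => h.
have x0 : 0 < dot x x.
  by rewrite dot_gt0; apply/eqP => x0; move: h; rewrite x0 dot0r ltxx.
pose t := dot (p - d) x / dot x x.
have t0 : 0 < t by rewrite divr_gt0.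
have := dmin' _ (dual_coneD (ltW t0) Kd Kx).
have -> : g (d + t *: x) = g d - 2 * t * dot (p - d) x + t * (t * dot x x).
  rewrite /g (_ : d + t *: x - p = t *: x - (p - d)); last first.
    by rewrite opprB addrCA addrA.
  rewrite -(opprB p d); move: (p - d) => e.
  by rewrite !dotBl !dotBr !dotD (dotC x e); ring.
rewrite divfK ?gt_eqF //; have := mulr_gt0 t0 h; lra.
Qed.

End DualCone.

(** * Separation *)

(** The hyperplane orthogonal to c separates A and B only weakly, and the bending
term has to be negative where B touches it without spoiling A. The quadratic
form |x N^T|^2 vanishes on A and is positive at those points of B, so that
subtracting it pushes the surface off B; adding del |y|^2 afterwards pushes it
off A, and for small del leaves B on its side. *)
Lemma separating_hypersurface (R : realType) m (c : 'rV[R]_m.+2)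
    (A B : set 'rV[R]_m.+2) r (N : 'M[R]_(r, m.+2)) :
  dot c c = 1 -> c *m N^T = 0 ->
  A `<=` sphere (n := m.+1) -> B `<=` sphere (n := m.+1) -> compact B ->
  (forall a, A a -> 0 <= dot a c) -> (forall a, A a -> a *m N^T = 0) ->
  (forall b, B b -> dot b c <= 0) ->
  (forall b, B b -> dot b c = 0 -> b *m N^T != 0) ->
  unlinked A B.
Proof.
move=> cc cN sA sB cB cA AN cBle BN.
have [L [LL cL frame]] := orthonormal_frame cc.
(* h bounds the side function on B from above before the shift by del *)
pose h b := dot b c - dot (b *m N^T) (b *m N^T).
have h0 b : B b -> h b < 0.
  move=> Bb; have := cBle b Bb; rewrite le_eqVlt => /orP[/eqP b0|b0].
    by rewrite /h b0 sub0r oppr_lt0 dot_gt0 BN.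
  by rewrite /h; have := dot_ge0 (b *m N^T); lra.
have ch : continuous h.
  have cN' : continuous (fun x : 'rV[R]_m.+2 => x *m N^T).
    exact: (Cr_continuous (Cr_mulmx 0 N^T)).
  move=> x; have c1 : {for x, continuous (fun x : 'rV[R]_m.+2 => dot x c)}.
    by apply: continuous_dot => //; exact: cst_continuous.
  exact: (cvgB c1 (continuous_dot (cN' x) (cN' x))).
have [del del0 hdel] : exists2 del, 0 < del & forall b, B b -> h b + del < 0.
  have [[b0 Bb0]|nB] := pselect (B !=set0); last first.
    by exists 1 => // b Bb; case: nB; exists b.
  have [b1 /set_mem Bb1 bmax] :=
    EVT_max_rV (ex_intro _ b0 Bb0) cB (continuous_subspaceT ch).
  have hb1 := h0 b1 Bb1; exists (- h b1 / 2); first by lra.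
  by move=> b Bb; have := bmax b (mem_set Bb); lra.
pose M := L *m N^T.
have [K K0 KM] := dot_mulmx_le M.
pose q y := del * dot y y - dot (y *m M) (y *m M).
have NM (x : 'rV[R]_m.+2) : x *m N^T = x *m L^T *m M.
  by rewrite {1}(frame x) mulmxDl -scalemxAl cN scaler0 add0r !mulmxA.
have xx x : dot x x = dot x c ^+ 2 + dot (x *m L^T) (x *m L^T).
  exact: frame_dotxx.
apply: (@side_unlinked R m L c LL cL cc frame q (del + K)) => //.
- move=> r'; have -> : q = (fun y => del *: (dot y y : R) +
      (- 1 : R) *: (dot (y *m M) (y *m M) : R)).
    by apply/funext => y; rewrite /q /GRing.scale /= mulN1r.
  have Cid : Cr r' (fun y : 'rV[R]_m.+1 => y).
    by have := Cr_mulmx r' (1%:M : 'M[R]_m.+1); under eq_fun do rewrite mulmx1.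
  apply: Cr_add; apply: Cr_scale; try exact: Cr_cst; apply: Cr_dot => //;
    exact: Cr_mulmx.
- move=> t y; rewrite /q -scalemxAl !dotD; ring.
- move=> y; have := KM y; have := dot_ge0 (y *m M); have := dot_ge0 y.
  rewrite /q ler_norml => p1 p2 p3.
  have p4 : 0 <= del * dot y y by rewrite mulr_ge0 // ltW.
  have p5 : 0 <= K * dot y y by rewrite mulr_ge0.
  by apply/andP; split; lra.
- move=> a Aa; rewrite /side /q -NM (AN a Aa) dot0l subr0.
  set y := a *m L^T; have := cA a Aa; rewrite -enorm_sqr.
  have [y0|y0] := eqVneq y 0.
    rewrite y0 enorm0 invr0 mulr0 addr0 => a0; rewrite lt_def a0 andbT.
    apply/eqP => ac0; have := xx a.
    rewrite -/y y0 ac0 dot0l expr0n addr0 (sA a Aa) => /eqP.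
    by rewrite oner_eq0.
  have r0 : 0 < enorm y by rewrite enorm_gt0.
  move=> a0; rewrite ltr_wpDl // !mulrA mulfK ?gt_eqF //.
  exact: mulr_gt0.
- move=> b Bb; rewrite /side /q -NM.
  have := hdel b Bb; rewrite /h; set Q := dot _ (b *m N^T).
  set y := b *m L^T => hb.
  have [y0|y0] := eqVneq y 0.
    have Q0 : Q = 0 by rewrite /Q NM -/y y0 mul0mx dot0l.
    by rewrite y0 enorm0 invr0 mulr0; lra.
  have r0 : 0 < enorm y by rewrite enorm_gt0.
  have r1 : enorm y <= 1.
    have : dot y y <= 1.
      by rewrite -(sB b Bb) (xx b) -/y lerDr sqr_ge0.
    rewrite -enorm_sqr; nra.
  have -> : (del * dot y y - Q) / enorm y = del * enorm y - Q / enorm y.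
    by rewrite -enorm_sqr; field; rewrite gt_eqF.
  have Q1 : Q <= Q / enorm y.
    by rewrite ler_pdivlMr // ler_piMr // dot_ge0.
  have d1 : del * enorm y <= del by rewrite ler_piMr // ltW.
  lra.
Qed.

(** The vector p, a positive combination of points that span the hull of A, lies
in the relative interior of the cone over A; this is what makes [dot p x = 0]
with x in the dual cone imply that x is orthogonal to A. *)
Lemma linked_orthogonal (R : realType) m (A B : set 'rV[R]_m.+2) :
  A `<=` sphere (n := m.+1) -> B `<=` sphere (n := m.+1) -> compact B ->
  (forall a b, A a -> B b -> dot a b <= 0) -> linked A B ->
  forall a b, A a -> B b -> dot a b = 0.
Proof.
move=> sA sB cB AB lAB.
have [s [sinA As]] := spanning_subset A.
pose p : 'rV[R]_m.+2 := \sum_(x <- s) x.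
have [d Kd dmin] := dual_cone_projection A p.
have KNB b : B b -> dual_cone A (- b).
  by move=> Bb a Aa; rewrite dotNr oppr_ge0 AB.
have px0 x : dual_cone A x -> dot p x = 0 -> forall a, a \in s -> dot a x = 0.
  move=> Kx; rewrite dot_suml big_seq => /eqP.
  rewrite psumr_eq0 => [/allP h a sa|a sa]; last exact: Kx (sinA a sa).
  by have := h a sa; rewrite sa /= => /eqP.
have orth x : (forall a, a \in s -> dot a x = 0) -> forall a, A a -> dot a x = 0.
  move=> h a Aa; rewrite dotC.
  by apply: (@orthogonal_span _ _ s) => [y ys|]; [rewrite dotC h|exact: As].
have [d0|d0] := eqVneq d 0.
  move=> a b Aa Bb; apply/eqP; rewrite -oppr_eq0 -dotNr; apply/eqP.
  apply: orth Aa; apply: px0; first exact: KNB.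
  apply/eqP; rewrite eq_le; apply/andP; split.
    by have := dmin _ (KNB b Bb); rewrite d0 subr0.
  rewrite dot_suml big_seq sumr_ge0 // => x xs.
  exact: KNB Bb x (sinA x xs).
exfalso; apply: lAB.
have r0 : 0 < enorm d by rewrite enorm_gt0.
pose c := (enorm d)^-1 *: d.
(* the rows of N span the orthogonal complement of A *)
pose G := \matrix_(i < size s) s`_i.
pose N := kermx G^T.
have GE x (i : 'I_(size s)) : (x *m G^T) 0 i = dot x s`_i.
  by rewrite mxE; apply: eq_bigr => j _; rewrite !mxE.
have NG i a : a \in s -> dot (row i N) a = 0.
  move=> sa; have ia : (index a s < size s)%N by rewrite index_mem.
  have := GE (row i N) (Ordinal ia); rewrite /= nth_index // => <-.
  by rewrite -row_mul mulmx_ker row0 mxE.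
have NE x : (forall i, dot (row i N) x = 0) -> x *m N^T = 0.
  move=> h; apply/rowP => i; rewrite [RHS]mxE -(h i) mxE.
  by apply: eq_bigr => j _; rewrite !mxE mulrC.
have NA i a : A a -> dot a (row i N) = 0.
  by apply: orth => x xs; rewrite dotC NG.
have db b : B b -> dot d b <= dot p b.
  by move=> Bb; have := dmin _ (KNB b Bb); rewrite dotNr dotBl; lra.
have pb b : B b -> dot p b <= 0.
  move=> Bb; rewrite dot_suml big_seq; apply: sumr_le0 => x xs.
  exact: AB (sinA x xs) Bb.
apply: (@separating_hypersurface R m c A B _ N) => //.
- by rewrite /c dotZl dotZr -enorm_sqr; field; rewrite gt_eqF.
- apply: NE => i; rewrite /c dotZr.
  have K1 t : dual_cone A (t *: row i N).
    by move=> a Aa; rewrite dotZr NA // mulr0.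
  have pN : dot p (row i N) = 0.
    by rewrite dot_suml big_seq big1 // => x xs; rewrite dotC NG.
  have := dmin _ (K1 1); have := dmin _ (K1 (-1)).
  rewrite !dotZr dotBl pN sub0r dotC => h1 h2.
  have -> : dot (row i N) d = 0 by lra.
  by rewrite mulr0.
- by move=> a Aa; rewrite /c dotZr mulr_ge0 ?Kd // invr_ge0 ltW.
- by move=> a Aa; apply: NE => i; rewrite dotC NA.
- move=> b Bb; rewrite /c dotZr pmulr_rle0 ?invr_gt0 // dotC.
  exact: le_trans (db b Bb) (pb b Bb).
- move=> b Bb; rewrite /c dotZr => /eqP.
  rewrite mulf_eq0 invr_eq0 gt_eqF //= dotC => /eqP db0.
  apply/eqP => bN.
  have pb0 : dot p b = 0 by have := db b Bb; have := pb b Bb; rewrite db0; lra.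
  have sb a : a \in s -> dot a b = 0.
    move=> sa; apply/eqP; rewrite -oppr_eq0 -dotNr; apply/eqP.
    by apply: px0 sa; [exact: KNB|rewrite dotNr pb0 oppr0].
  have /sub_kermxP : b *m G^T = 0.
    by apply/rowP => i; rewrite GE dotC sb ?mxE // mem_nth.
  case/submxP => z bz.
  have : dot b b = 0 by rewrite {1}bz dot_mulmx bN dot0r.
  by rewrite (sB b Bb) => /eqP; rewrite oner_eq0.
Qed.

(** * Distance, joins and dual great spheres *)

Lemma acos_lt_pihalf (R : realType) (y : R) :
  -1 <= y <= 1 -> (acos y < pi / 2) = (0 < y).
Proof.
move=> y1; rewrite -(cos_pihalf R) -{2}(acosK y1) ltr_cos // in_itv /=.
  by rewrite acos_ge0 // acos_lepi.
by have := pi_ge0 R; move=> ?; apply/andP; split; lra.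
Qed.

Section Duality.
Variables (R : realType) (n : nat).
Implicit Types A B : set 'rV[R]_n.+1.

Lemma embedded_sphere_compact k A : embedded_sphere k A -> compact A.
Proof.
move=> [_ [f [[[U [_ sU fC]] _ _] ->]]].
apply: continuous_compact; last exact: sphere_compact.
apply: continuous_in_subspaceT => x /set_mem sx.
by case: (fC 0%N) => cf _; apply: cf; exact: sU.
Qed.

Lemma embedded_sphere_nonempty k A : embedded_sphere k A -> A !=set0.
Proof.
move=> [_ [f [_ ->]]]; exists (f (delta_mx 0 0)), (delta_mx 0 0) => //.
exact: delta_sphere.
Qed.

(** The linear hulls are orthogonal, and their dimensions are at least k + 1 and
l + 1 in a space of dimension k + l + 2. *)
Lemma orthogonal_dual_great_spheres k l A B : n = (k + l + 1)%N ->
  embedded_sphere k A -> embedded_sphere l B ->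
  (forall a b, A a -> B b -> dot a b = 0) -> dual_great_spheres k A B.
Proof.
move=> hn hA hB AB.
have [s [sA As]] := spanning_subset A; have [t [tB Bt]] := spanning_subset B.
have PQ p q : p \in span s -> q \in span t -> dot p q = 0.
  move=> ps qt; apply: (@orthogonal_span _ _ t) qt => b bt.
  rewrite dotC; apply: (@orthogonal_span _ _ s) ps => a sa.
  by rewrite dotC; apply: AB; [exact: sA|exact: tB].
have [kP surA] := embedded_sphere_span hA As.
have [lQ surB] := embedded_sphere_span hB Bt.
have dPQ := dim_orthogonal PQ.
have [kP' lQ'] : \dim (span s) = k.+1 /\ \dim (span t) = l.+1.
  move: kP lQ dPQ hn; move: (\dim _) (\dim _) => i j ki lj ij.
  by split; lia.
have PQn : (\dim (span s) + \dim (span t))%N = n.+1 by rewrite kP' lQ'; lia.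
have Qo := orthogonal_complement_eq PQ PQn.
exists (span s); split=> //; apply/seteqP; split=> x.
- by move=> Ax; split; [case: hA => + _; exact|exact: As].
- by move=> [sx xs]; exact: surA.
- move=> Bx; split; first by case: hB => + _; exact.
  by rewrite -Qo; exact: Bt.
- by move=> [sx]; rewrite -Qo; exact: surB.
Qed.

(** The point a0 serves the case p = 0, where any direction will do. *)
Lemma unit_direction A (P : set 'rV[R]_n.+1) a0 p :
  A = sphere (n := n) `&` P -> A a0 -> P p ->
  (forall t x, P x -> P (t *: x)) -> exists2 a, A a & p = enorm p *: a.
Proof.
move=> AE Aa0 Pp PZ; have [->|p0] := eqVneq p 0.
  by exists a0 => //; rewrite enorm0 scale0r.
have r0 : enorm p != 0 by rewrite gt_eqF // enorm_gt0.
exists ((enorm p)^-1 *: p); last by rewrite scalerA mulfV // scale1r.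
rewrite AE; split; last exact: PZ.
by rewrite /sphere /= dotZl dotZr -enorm_sqr; field.
Qed.

Lemma dual_great_spheres_orthogonal k A B a b :
  dual_great_spheres k A B -> A a -> B b -> dot a b = 0.
Proof.
by move=> [P [_ -> ->]] [_ aP] [_ bP]; rewrite dotC; exact: bP.
Qed.

(** With x = p + r in P and its complement, |p|^2 + |r|^2 = 1, so |p| and |r| are
the cosine and sine of an angle between 0 and pi/2. *)
Lemma dual_great_spheres_join k A B : A !=set0 -> B !=set0 ->
  dual_great_spheres k A B -> sphere_is_join A B.
Proof.
move=> [a0 Aa0] [b0 Bb0] dAB; split.
  move=> a b Aa Bb; rewrite /geod_dist.
  by rewrite (dual_great_spheres_orthogonal dAB Aa Bb) acos0.
have [P [_ AE BE]] := dAB; apply/seteqP; split=> x; last first.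
  move=> [a [b [t [Aa Bb _ ->]]]]; apply: great_circle_sphere.
  - by move: Aa; rewrite AE => -[].
  - by move: Bb; rewrite BE => -[].
  - exact: dual_great_spheres_orthogonal dAB Aa Bb.
rewrite /sphere /= => xx.
have [p [r [pP rP xE]]] := orthogonal_decomposition P x.
have [|a Aa pa] := @unit_direction A [set x | x \in P] a0 p AE Aa0 pP.
  by move=> t y yP; exact: memvZ.
have [|b Bb rb] := @unit_direction B (orthogonal_complement P) b0 r BE Bb0 rP.
  by move=> t y yP z zP; rewrite dotZl yP // mulr0.
have pr : dot p r = 0 by rewrite dotC rP.
have e1 : enorm p ^+ 2 + enorm r ^+ 2 = 1.
  rewrite !expr2 !enorm_sqr -xx xE !dotD (dotC r) pr; ring.
have p0 : 0 <= enorm p by exact: sqrtr_ge0.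
have r0 : 0 <= enorm r by exact: sqrtr_ge0.
have p1 : -1 <= enorm p <= 1 by apply/andP; split; nra.
exists a, b, (acos (enorm p)); split=> //.
  rewrite acos_ge0 //=; move: r0 p0; rewrite le_eqVlt => _.
  rewrite le_eqVlt => /orP[/eqP <-|p0]; first by rewrite acos0.
  by rewrite ltW // acos_lt_pihalf.
rewrite acosK // sin_acos // -e1 addrAC subrr add0r sqrtr_sqr ger0_norm //.
by rewrite -pa -rb.
Qed.

Lemma join_orthogonal A B a b : A `<=` sphere (n := n) -> B `<=` sphere (n := n) ->
  sphere_is_join A B -> A a -> B b -> dot a b = 0.
Proof.
move=> sA sB [h _] Aa Bb; have := h a b Aa Bb; rewrite /geod_dist => e.
rewrite -(acosK (dot_unit_itv (sA a Aa) (sB b Bb))) e cos_pihalf //.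
Qed.

Lemma set_dist_orthogonal A B : A !=set0 -> B !=set0 ->
  (forall a b, A a -> B b -> dot a b = 0) -> set_dist A B = pi / 2.
Proof.
move=> [a0 Aa0] [b0 Bb0] h; rewrite /set_dist.
rewrite (_ : [set _ | _ in _ & _ in _] = [set pi / 2]) ?inf1 //.
apply/seteqP; split=> y /=.
  by move=> [a Aa [b Bb <-]]; rewrite /geod_dist h // acos0.
by move=> ->; exists a0 => //; exists b0 => //; rewrite /geod_dist h // acos0.
Qed.

Lemma set_dist_ge_pihalf A B : A `<=` sphere (n := n) -> B `<=` sphere (n := n) ->
  pi / 2 <= set_dist A B -> forall a b, A a -> B b -> dot a b <= 0.
Proof.
move=> sA sB h a b Aa Bb.
have abI := dot_unit_itv (sA a Aa) (sB b Bb).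
have h1 : pi / 2 <= acos (dot a b).
  apply: le_trans h _; apply: ge_inf; last by exists a => //; exists b.
  exists 0 => _ [x Ax [y By <-]]; apply: acos_ge0.
  exact: dot_unit_itv (sA x Ax) (sB y By).
by rewrite leNgt -acos_lt_pihalf // -leNgt.
Qed.

End Duality.

Unset Implicit Arguments.
Set Strict Implicit.

Theorem theorem1p3 (R : realType) (k l n : nat) (hn : n = (k + l + 1)%N)
    (A B : set 'rV[R]_n.+1)
    (hA : embedded_sphere k A) (hB : embedded_sphere l B)
    (hAB : linked A B) :
  [/\ set_dist A B <= pi / 2,
      set_dist A B = pi / 2 <-> sphere_is_join A B
    & sphere_is_join A B <-> dual_great_spheres k A B].
Proof.
have sA : A `<=` sphere (n := n) by case: hA.
have sB : B `<=` sphere (n := n) by case: hB.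
have A0 := embedded_sphere_nonempty hA; have B0 := embedded_sphere_nonempty hB.
have far_orth : pi / 2 <= set_dist A B -> forall a b, A a -> B b -> dot a b = 0.
  move=> h; have AB := set_dist_ge_pihalf sA sB h.
  have cB := embedded_sphere_compact hB.
  clear hA hB A0 B0 h; move: A B sA sB hAB cB AB; rewrite hn addn1 => A B.
  by move=> sA sB lAB cB AB; exact: linked_orthogonal.
have orth_dual := orthogonal_dual_great_spheres hn hA hB.
have dual_join := @dual_great_spheres_join R n k A B A0 B0.
split.
- rewrite leNgt; apply/negP => h.
  have := set_dist_orthogonal A0 B0 (far_orth (ltW h)) => e.
  by move: h; rewrite e ltxx.
- split=> [e|j]; first by apply/dual_join/orth_dual/far_orth; rewrite e.
  by apply: set_dist_orthogonal => // a b; exact: join_orthogonal.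
- by split=> // j; apply: orth_dual => a b; exact: join_orthogonal.
Qed.
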